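(* There exists an absolute constant $c>0$ such that for every integer $n\ge 2$ there is a set of $n$ points in the plane $\mathbb{R}^2$ with minimum distance at least one such that the $\binom n2$ distances $d_1\le d_2\le\dots\le d_{\binom n2}$ determined by pairs of its points satisfy $$\sum_{1\le i<\binom n2}(d_{i+1}-d_i)^2\le c\,n^{-6/7}.$$
   Context: Distances are Euclidean. For a set of $n$ points in the plane, $d_1\le d_2\le\dots\le d_{\binom n2}$ is the list, in non-decreasing order and with multiplicity, of the distances between its $\binom n2$ pairs of distinct points. ''Minimum distance at least one'' means $d_1\ge 1$. *)

(* Defs.v *)
From HB Require Import structures.
From mathcomp Require Import all_boot all_order all_algebra.
From mathcomp Require Import reals.

Set Implicit Arguments.
Unset Strict Implicit.
Unset Printing Implicit Defensive.

Import Order.TTheory GRing.Theory Num.Theory.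

Local Open Scope ring_scope.

(* The library norm on row vectors is the sup norm, hence an explicit
   Euclidean distance. *)
Definition edist (R : realType) (x y : 'rV[R]_2) : R :=
  Num.sqrt (\sum_(k < 2) (x 0 k - y 0 k) ^+ 2).

(* Each unordered pair of indices is listed once, as (i, j) with i < j. *)
Definition distances (R : realType) (n : nat) (p : 'I_n -> 'rV[R]_2) : seq R :=
  sort <=%R
    [seq edist (p ij.1) (p ij.2) | ij in [pred ij : 'I_n * 'I_n | (ij.1 < ij.2)%N]].

(* d_k with the 1-based numbering d_1 <= ... <= d_('C(n, 2)); only
   1 <= k <= 'C(n, 2) is meaningful (d_k = d_1 for k = 0, and 0 beyond). *)
Definition dist_nth (R : realType) (n : nat) (p : 'I_n -> 'rV[R]_2)
  (k : nat) : R := (distances p)`_(k.-1).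

Lemma size_distances (R : realType) (n : nat) (p : 'I_n -> 'rV[R]_2) :
  size (distances p) = 'C(n, 2).
Proof.
rewrite size_sort size_image -bin2_sum big_mkord -sum1_card.
rewrite -(pair_big_dep xpredT (fun i j : 'I_n => i < j)%N (fun _ _ => 1%N)) /=.
rewrite (exchange_big_dep xpredT) //=; apply: eq_bigr => j _.
rewrite -(big_ord_widen_cond n xpredT (fun _ => 1%N)) ?sum1_card ?card_ord //.
exact: ltnW.
Qed.

Lemma sorted_distances (R : realType) (n : nat) (p : 'I_n -> 'rV[R]_2) :
  sorted <=%R (distances p).
Proof. exact: sort_le_sorted. Qed.

(* Main.v *)
Require Import Defs.
From HB Require Import structures.
From mathcomp Require Import all_boot all_order all_algebra.
From mathcomp Require Import reals topology derive sequences exp trigo.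
From mathcomp Require Import ring lra zify.

(* Take [n ~ N^7] and place the points on about [N^3] concentric circles of
   radii near [r = 16 m], [m = N^4], with [m] points on each.  On the circles of
   one family the points are [2 pi / m] apart, on those of the other family
   [2 pi (m - 1) / m^2]; for one circle of each family the differences of angles
   are all the multiples of [2 pi / m^2], up to a shift.  The circles are
   rotated by independent random multiples of a much smaller angle.  For a test
   radius [x] and [S * W] pairs of circles that can realise the distance [x],
   the random shifts make the expected distance from [x] down to the closest
   realised distance [O(L / (S W m^2))], where [L] is the slope of the chord
   length as a function of the angle: [L <= r] always, and [L = O(sqrt (r t))]
   at depth [t] below the diameter.  The sum of the squared gaps is essentially
   twice the integral of that distance over [x].  At depth [t <= N^3] one can
   take [S = W ~ t], and the integral of [sqrt (r t) / (t^2 m^2)] is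
   [O(N^(-6))]; elsewhere [S ~ N^3] and [W ~ min (x, N^3)] up to a factor [N],
   which again gives [O(N^(-6))].  The first few units below the diameter are
   covered by two opposite arcs on the outermost circle. *)

Set Implicit Arguments.
Unset Strict Implicit.
Unset Printing Implicit Defensive.

Import Order.TTheory GRing.Theory Num.Theory numFieldTopology.Exports.

Local Open Scope ring_scope.

(** * Covering a cyclic group by randomly shifted arcs *)

Definition ffun_upd (I T : finType) (f : {ffun I -> T}) (i : I) (z : T) :
  {ffun I -> T} := [ffun k => if k == i then z else f k].

(** Exchanging [t i] with [z] is an involution on the pairs [(t, z)], so resampling one coordinate
    preserves the uniform measure. *)
Lemma sum_ffun_upd (R : realType) (I T : finType) (F : {ffun I -> T} -> R)
    (i : I) :
  \sum_(t : {ffun I -> T}) \sum_(z : T) F (ffun_upd t i z)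
  = #|T|%:R * \sum_(t : {ffun I -> T}) F t.
Proof.
pose h (p : {ffun I -> T} * T) := (ffun_upd p.1 i p.2, p.1 i).
have hK : cancel h h.
  case=> t z; rewrite /h /=; congr (_, _); last by rewrite ffunE eqxx.
  by apply/ffunP => k; rewrite !ffunE; case: eqP => // ->.
rewrite pair_big /= (reindex h) /=; last by exists h => p _; exact: hK.
rewrite (eq_bigr (fun p : {ffun I -> T} * T => F p.1)); last first.
  move=> [t z] _ /=; congr (F _); apply/ffunP => k; rewrite !ffunE.
  by have [->|ne] := eqVneq k i; rewrite ?eqxx ?(negbTE ne).
rewrite -(pair_bigA _ (fun t (z : T) => F t)) mulr_sumr.
by apply: eq_bigr => t _; rewrite /= sumr_const mulr_natl.
Qed.

(** On [[0, 1]] one has [(1 - y / 2) * (1 + y) >= 1], and [1 + y] is at most the exponential of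
    [y]. *)
Lemma expRN_le (R : realType) (y : R) : 0 <= y <= 1 -> expR (- y) <= 1 - y / 2.
Proof.
move=> /andP[y0 y1]; rewrite expRN -[leRHS]invrK lef_pV2 ?posrE ?expR_gt0//.
  apply: le_trans (expR_ge1Dx y); rewrite -[leLHS]mul1r ler_pdivrMr; nra.
by rewrite invr_gt0; lra.
Qed.

(** With [H i j z] the set of values of [u j] for which the pair [(i, j)] hits when [t i = z], these
    are the values of [u j] that produce a hit with some circle listed in [s]. *)
Definition covered (I J T : finType) (H : I -> J -> T -> {set T})
    (adj : I -> J -> bool) (s : seq I) (t : {ffun I -> T}) (j : J) : {set T} :=
  \bigcup_(i <- s | adj i j) H i j (t i).

Lemma card_covered (I J T : finType) (H : I -> J -> T -> {set T})
    (adj : I -> J -> bool) (kap W : nat) (s : seq I) (t : {ffun I -> T})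
    (j : J) :
  (forall i j z, (#|H i j z| <= kap)%N) -> (count (adj^~ j) s <= W)%N ->
  (#|covered H adj s t j| <= W * kap)%N.
Proof.
move=> Hle cW; apply: leq_trans (_ : _ <= count (adj^~ j) s * kap)%N _;
  last first.
  by rewrite leq_mul2r cW orbT.
elim: s {cW} => [|i s IH]; first by rewrite /covered big_nil cards0.
rewrite /covered big_cons /=; case: ifP => _ //.
rewrite mulnDl mul1n; apply: leq_trans (leq_card_setU _ _) _.
exact: leq_add.
Qed.

(* The coordinates of [t] are resampled one at a time: given the others, [t i]
   increases the total covered size by some [Y] with [Y <= W * kap <= #|T| / 2]
   and mean at least [W * kap / 2], because at least half of each target
   [j] adjacent to [i] is still uncovered. *)
Lemma sum_expR_covered (R : realType) (I J T : finType)
    (H : I -> J -> T -> {set T}) (adj : I -> J -> bool) (kap W : nat)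
    (s : seq I) :
  uniq s -> (0 < #|T|)%N ->
  (forall i j z, (#|H i j z| <= kap)%N) ->
  (forall i j y, (kap <= #|[set z | y \in H i j z]|)%N) ->
  (forall i, i \in s -> #|[set j | adj i j]| = W) ->
  (forall j, (count (adj^~ j) s <= W)%N) ->
  (2 * W * kap <= #|T|)%N ->
  \sum_(t : {ffun I -> T})
     expR (- (\sum_j #|covered H adj s t j|)%:R / #|T|%:R : R)
  <= #|T|%:R ^+ #|I| * expR (- (size s * W * kap)%:R / (4 * #|T|%:R)).
Proof.
move=> us T0 Hle Hge sW cW WT.
have T0R : 0 < #|T|%:R :> R by rewrite ltr0n.
elim: s us sW cW => [|i s IH] /= us sW cW.
  rewrite !mul0n mulr0n oppr0 mul0r expR0 mulr1.
  rewrite (eq_bigr (fun=> 1)); last first.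
    move=> t _; rewrite big1 ?mulr0n ?oppr0 ?mul0r ?expR0// => j _.
    by rewrite /covered big_nil cards0.
  by rewrite sumr_const card_ffun natrX.
case/andP: us => nis us.
have cW' j : (count (adj^~ j) s <= W)%N by apply: leq_trans (cW j);
  exact: leq_addl.
have sW' k : k \in s -> #|[set j | adj k j]| = W.
  by move=> ks; apply: sW; rewrite inE ks orbT.
have {}IH := IH us sW' cW'.
rewrite -(ler_pM2l T0R) -(sum_ffun_upd _ i).
pose r : R := expR (- (W * kap)%:R / (4 * #|T|%:R)).
apply: (@le_trans _ _ (\sum_(t : {ffun I -> T}) #|T|%:R * r *
    expR (- (\sum_j #|covered H adj s t j|)%:R / #|T|%:R))).
  apply: ler_sum => t _.
  pose Y z := (\sum_(j | adj i j) #|H i j z :\: covered H adj s t j|)%N.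
  have PhiE z : (\sum_j #|covered H adj (i :: s) (ffun_upd t i z) j| =
                 \sum_j #|covered H adj s t j| + Y z)%N.
    rewrite /Y [X in (_ + X)%N]big_mkcond -big_split /=; apply: eq_bigr => j _.
    rewrite /covered big_cons ffunE eqxx.
    have -> : \bigcup_(k <- s | adj k j) H k j (ffun_upd t i z k) =
              \bigcup_(k <- s | adj k j) H k j (t k).
      rewrite big_seq_cond [RHS]big_seq_cond; apply: eq_bigr => k /andP[ks _].
      rewrite ffunE; case: eqP => // ki; by rewrite -ki ks in nis.
    case: ifP => _; last by rewrite addn0.
    set U := \bigcup_(_ <- _ | _) _.
    rewrite -(cardsID U (_ :|: _)) setDUl setDv setU0; congr (_ + _)%N.
    by rewrite setUC setUK.
  have WE : (W * kap = \sum_(j | adj i j) kap)%N.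
    by rewrite sum_nat_const -(sW i) ?mem_head// cardsE.
  have Yle z : (Y z <= W * kap)%N.
    rewrite WE; apply: leq_sum => j _.
    by apply: leq_trans (Hle i j z); apply: subset_leq_card; exact: subsetDl.
  have Ysum : (W * kap * #|T| <= 2 * \sum_z Y z)%N.
    rewrite /Y exchange_big /= WE big_distrl big_distrr /=;
      apply: leq_sum => j _.
    have -> : (\sum_z #|H i j z :\: covered H adj s t j| =
       \sum_(y in ~: covered H adj s t j) #|[set z | y \in H i j z]|)%N.
      under eq_bigr do rewrite -sum1_card big_mkcond /=.
      under [RHS]eq_bigr do rewrite -sum1_card big_mkcond /=.
      rewrite exchange_big [RHS]big_mkcond /=; apply: eq_bigr => y _.
      rewrite inE; case: ifPn => yU.
        by apply: eq_bigr => z _; rewrite !inE yU.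
      by rewrite big1// => z _; rewrite inE (negbTE yU).
    apply: leq_trans (_ : _ <= 2 * \sum_(y in ~: covered H adj s t j) kap)%N _.
      rewrite sum_nat_const cardsCs setCK mulnA [leqLHS]mulnC leq_mul2r.
      have := card_covered t Hle (cW' j); move: WT => /=; rewrite -mulnA.
      move=> h1 h2; apply/orP; right; rewrite mulnBr; lia.
    by rewrite leq_mul2l /=; apply: leq_sum => y _; exact: Hge.
  rewrite (eq_bigr (fun z =>
     expR (- (\sum_j #|covered H adj s t j|)%:R / #|T|%:R) *
     expR (- ((Y z)%:R / #|T|%:R) : R))); last first.
    by move=> z _; rewrite PhiE -expRD natrD opprD mulrDl !mulNr.
  rewrite -mulr_sumr mulrC ler_wpM2r ?expR_ge0//.
  apply: (@le_trans _ _ (\sum_z (1 - (Y z)%:R / #|T|%:R / 2))).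
    apply: ler_sum => z _; apply: expRN_le; rewrite divr_ge0 ?ler0n//=.
    rewrite ler_pdivrMr// mul1r ler_nat.
    by apply: leq_trans (leq_trans (Yle z) _) WT; rewrite -mulnA leq_pmull.
  rewrite sumrB sumr_const -mulr_natr mul1r -!mulr_suml -natr_sum.
  have -> : #|T|%:R * r = #|T|%:R * expR (- ((W * kap)%:R / (4 * #|T|%:R))).
    by rewrite /r mulNr.
  apply: (@le_trans _ _ (#|T|%:R * (1 - (W * kap)%:R / (4 * #|T|%:R)))).
    have : (W * kap * #|T|)%:R <= (2 * \sum_z Y z)%:R :> R by rewrite ler_nat.
    rewrite !natrM; set y := (\sum_z Y z)%:R; set T' := #|T|%:R => h.
    have T'0 : T' != 0 by rewrite gt_eqF.
    rewrite (_ : T' * _ = T' - W%:R * kap%:R / 4); last by field.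
    rewrite lerD2l lerN2 -[leRHS]mulrA -invfM ler_pdivlMr ?mulr_gt0//; nra.
  by rewrite ler_wpM2l ?ler0n//; exact: le_trans (expR_ge1Dx _).
rewrite -mulr_sumr -mulrA ler_wpM2l ?ler0n//.
apply: (le_trans (ler_wpM2l (expR_ge0 _) IH)).
rewrite /r mulrCA ler_wpM2l ?exprn_ge0 ?ler0n// -expRD le_eqVlt.
apply/orP; left; apply/eqP; congr expR; rewrite -mulrDl; congr (_ / _).
by rewrite -opprD -natrD -mulnA -mulSn mulnA.
Qed.

(** For fixed [t] the coordinates [u j] are independent, so the probability that all of them miss is
    the product of the factors [1 - #|covered| / #|T|], at most the exponential averaged in
    [sum_expR_covered]. *)
Lemma sum_missed (R : realType) (I J T : finType)
    (H : I -> J -> T -> {set T}) (adj : I -> J -> bool) (kap W : nat)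
    (s : seq I) :
  uniq s -> (0 < #|T|)%N ->
  (forall i j z, (#|H i j z| <= kap)%N) ->
  (forall i j y, (kap <= #|[set z | y \in H i j z]|)%N) ->
  (forall i, i \in s -> #|[set j | adj i j]| = W) ->
  (forall j, (count (adj^~ j) s <= W)%N) ->
  (2 * W * kap <= #|T|)%N ->
  \sum_(t : {ffun I -> T}) \sum_(u : {ffun J -> T})
     [forall j, u j \notin covered H adj s t j]%:R
  <= #|T|%:R ^+ (#|I| + #|J|)
     * expR (- (size s * W * kap)%:R / (4 * #|T|%:R)) :> R.
Proof.
move=> us T0 Hle Hge sW cW WT.
have T0R : 0 < #|T|%:R :> R by rewrite ltr0n.
apply: (@le_trans _ _ (\sum_(t : {ffun I -> T}) #|T|%:R ^+ #|J| *
    expR (- (\sum_j #|covered H adj s t j|)%:R / #|T|%:R))); last first.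
  rewrite -mulr_sumr addnC exprD -mulrA ler_wpM2l ?exprn_ge0 ?ler0n//.
  exact: sum_expR_covered.
apply: ler_sum => t _.
rewrite (eq_bigr (fun u : {ffun J -> T} =>
   \prod_j (u j \notin covered H adj s t j)%:R)); last first.
  move=> u _; case: (boolP [forall j, _]) => [/forallP h|].
    by rewrite big1// => j _; rewrite h.
  rewrite negb_forall => /existsP[j hj].
  by rewrite (bigD1 j)//= (negbTE hj) mul0r.
rewrite -(bigA_distr_bigA (fun j z => (z \notin covered H adj s t j)%:R)) /=.
rewrite natr_sum mulNr mulr_suml -sumrN.
rewrite (big_morph _ (@expRD R) (@expR0 R)).
have -> : #|T|%:R ^+ #|J| = \prod_(j : J) (#|T|%:R : R) by rewrite prodr_const.
rewrite -big_split /=; apply: ler_prod => j _; rewrite sumr_ge0//=.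
rewrite -natr_sum (eq_bigr (fun z => if z \in ~: covered H adj s t j then 1%N
  else 0%N)); last first.
  by move=> z _; rewrite inE; case: (_ \in _).
rewrite -big_mkcond sum1_card cardsCs setCK natrB ?max_card//.
apply: le_trans (ler_wpM2l (ler0n _ _) (expR_ge1Dx _)).
by rewrite mulrDr mulr1 mulrN mulrCA divff ?gt_eqF// mulr1.
Qed.

(* [t i] and [u j] are the shifts of circle [i] of the first family and circle
   [j] of the second one; [W] consecutive circles [j] are compared to each
   [i < S], and [z0 i j] is the end of the target arc of [kap] residues. *)
Definition hits (M w S W kap : nat) (z0 : nat -> nat -> nat)
    (t u : {ffun 'I_w -> 'I_M}) : bool :=
  [exists i : 'I_w, exists j : 'I_w, exists k : 'I_kap,
     [&& (i < S)%N, (i <= j < i + W)%N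
       & (t i + k == z0 i j + u j %[mod M])%N]].

Lemma card_ord_itv (n a b : nat) : (b <= n)%N ->
  #|[pred j : 'I_n | (a <= j < b)%N]| = (b - a)%N.
Proof.
move=> bn; rewrite -sum1_card (eq_bigl (fun j : 'I_n => (a <= j < b)%N)) //.
rewrite -(big_ord_widen_cond n (fun j => (a <= j)%N) (fun=> 1%N) bn).
have := big_geq_mkord (op := addn) a b xpredT (fun=> 1%N) => /= <-.
by rewrite sum_nat_const_nat muln1.
Qed.

Definition arc (M kap z0 : nat) (z : 'I_M) : {set 'I_M} :=
  [set y : 'I_M | [exists k : 'I_kap, (z + k == z0 + y %[mod M])%N]].

Lemma card_arc (M kap z0 : nat) (z : 'I_M) : (#|arc kap z0 z| <= kap)%N.
Proof.
have M0 : (0 < M)%N by apply: leq_trans (ltn_ord z).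
pose f (k : 'I_kap) := Ordinal (ltn_pmod (z + k + (M - z0 %% M)) M0).
apply: leq_trans (_ : _ <= #|f @: [set: 'I_kap]|)%N _; last first.
  by apply: leq_trans (leq_imset_card _ _) _; rewrite cardsT card_ord.
apply: subset_leq_card; apply/subsetP => y; rewrite inE => /existsP[k /eqP zk].
apply/imsetP; exists k => //; apply/val_inj => /=.
rewrite -modnDml zk modnDml.
have -> : (z0 + y + (M - z0 %% M) = (z0 %/ M).+1 * M + y)%N.
  have := ltn_pmod z0 M0; rewrite [X in (X + y)%N](divn_eq z0 M); lia.
by rewrite modnMDl modn_small.
Qed.

Lemma card_arc_dual (M kap z0 : nat) (y : 'I_M) : (kap <= M)%N ->
  (kap <= #|[set z | y \in arc kap z0 z]|)%N.
Proof.
move=> kM; have M0 : (0 < M)%N by apply: leq_trans (ltn_ord y).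
pose f (k : 'I_kap) := Ordinal (ltn_pmod (z0 + y + (M - k)) M0).
have finj : injective f.
  move=> k k' /(congr1 val)/= /eqP; rewrite eqn_modDl => /eqP h.
  apply/val_inj => /=; have := ltn_ord k; have := ltn_ord k'.
  have : (M - k + (k + k') = M - k' + (k + k') %[mod M])%N.
    by rewrite -modnDml h modnDml.
  move=> + lk' lk; rewrite addnA subnK; last by apply: ltnW;
    apply: leq_trans kM.
  rewrite [(k + k')%N]addnC addnA subnK; last by apply: ltnW;
    apply: leq_trans kM.
  by rewrite !modnDl !modn_small//; apply: leq_trans kM.
rewrite -[leqLHS]card_ord -cardsT -(card_imset _ finj); apply: subset_leq_card.
apply/subsetP => z /imsetP[k _ ->]; rewrite !inE; apply/existsP; exists k => /=.
rewrite modnDml -addnA subnK ?modnDr//; apply: ltnW.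
exact: leq_trans (ltn_ord k) kM.
Qed.

Lemma sum_missed_arcs (R : realType) (M w S W kap : nat)
    (z0 : nat -> nat -> nat) :
  (0 < M)%N -> (0 < W)%N -> (S + W <= w)%N -> (2 * W * kap <= M)%N ->
  \sum_(t : {ffun 'I_w -> 'I_M}) \sum_(u : {ffun 'I_w -> 'I_M})
     (~~ hits S W kap z0 t u)%:R
  <= M%:R ^+ (w + w) * expR (- (S * W * kap)%:R / (4 * M%:R)) :> R.
Proof.
move=> M0 W0 SW WM.
pose adj (i j : 'I_w) := (i <= j < i + W)%N.
pose s := [seq i : 'I_w <- enum 'I_w | (i < S)%N].
pose H (i j : 'I_w) (z : 'I_M) := arc kap (z0 i j) z.
have szs : size s = S.
  have Sw : (S <= w)%N by exact: leq_trans (leq_addr _ _) SW.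
  rewrite -[RHS](subn0 S) -(card_ord_itv 0 Sw) cardE /s enumT /enum_mem.
  by congr size; apply: eq_filter.
have kM : (kap <= M)%N.
  by apply: leq_trans WM; rewrite leq_pmull// muln_gt0.
have us : uniq s by rewrite filter_uniq// enum_uniq.
have T0 : (0 < #|'I_M|)%N by rewrite card_ord.
have Hle i j z : (#|H i j z| <= kap)%N by exact: card_arc.
have Hge i j y : (kap <= #|[set z | y \in H i j z]|)%N by exact: card_arc_dual.
have sW i : i \in s -> #|[set j | adj i j]| = W.
  rewrite mem_filter => /andP[iS _]; rewrite cardsE card_ord_itv ?addKn//.
  apply: leq_trans SW; rewrite leq_add2r; exact: ltnW.
have cW j : (count (adj^~ j) s <= W)%N.
  rewrite count_filter.
  apply: leq_trans (_ : #|[pred i : 'I_w | (j.+1 - W <= i < j.+1)%N]| <= W)%N.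
    rewrite enumT cardE /enum_mem size_filter.
    by apply: sub_count => i /=; rewrite /adj !inE; lia.
  by rewrite card_ord_itv//; lia.
have WT : (2 * W * kap <= #|'I_M|)%N by rewrite card_ord.
have := sum_missed R us T0 Hle Hge sW cW WT; rewrite szs !card_ord.
apply: le_trans; apply: ler_sum => t _; apply: ler_sum => u _.
rewrite ler_nat; case: (boolP (hits _ _ _ _ _ _)) => //= nh.
suff -> : [forall j, u j \notin covered H adj s t j] by [].
apply/forallP => j; apply: contra nh; rewrite /covered -big_filter bigcup_seq.
case/bigcupP => i; rewrite !mem_filter => /and3P[ij iS _].
rewrite inE => /existsP[k hk].
by apply/existsP; exists i; apply/existsP; exists j; apply/existsP; exists k;
  apply/and3P.
Qed.

Lemma leq_hits (M w S W kap kap' : nat) (z0 : nat -> nat -> nat)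
    (t u : {ffun 'I_w -> 'I_M}) :
  (kap <= kap')%N -> hits S W kap z0 t u -> hits S W kap' z0 t u.
Proof.
move=> kk /existsP[i /existsP[j /existsP[k h]]].
apply/existsP; exists i; apply/existsP; exists j; apply/existsP.
by exists (widen_ord kk k).
Qed.

(** An arc of [M] or more residues is the whole cyclic group, so the pair [(0, 0)] already hits.
    This bounds the search in [wait_hits]. *)
Lemma hits_full (M w S W kap : nat) (z0 : nat -> nat -> nat)
    (t u : {ffun 'I_w -> 'I_M}) :
  (0 < S)%N -> (0 < W)%N -> (0 < w)%N -> (M <= kap)%N -> hits S W kap z0 t u.
Proof.
move=> S0 W0 w0 Mk.
pose i := Ordinal w0; have M0 : (0 < M)%N by apply: leq_trans (ltn_ord (t i)).
have kP : ((z0 i i + u i + (M - t i)) %% M < kap)%N.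
  by apply: leq_trans Mk; exact: ltn_pmod.
apply/existsP; exists i; apply/existsP; exists i; apply/existsP.
exists (Ordinal kP); rewrite S0 leqnn -[X in (X < _)%N]addn0 ltn_add2l W0 /=.
by rewrite modnDmr addnCA subnKC ?modnDr// ltnW.
Qed.

(* With arcs of this length, the [S * W] pairs of circles produce about one hit
   on average. *)
Definition arc_step (M S W : nat) : nat := (M %/ (S * W)).+1.

(* An upper bound for the number of arc steps before the first hit, written as
   a sum of indicators so that its mean is immediate. *)
Definition wait (M w S W : nat) (z0 : nat -> nat -> nat)
    (t u : {ffun 'I_w -> 'I_M}) : nat :=
  (1 + \sum_(1 <= k < (S * W).+1) ~~ hits S W (k * arc_step M S W) z0 t u)%N.

Lemma arc_step_ge (M S W : nat) : (0 < S * W)%N ->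
  (M <= S * W * arc_step M S W)%N.
Proof. by move=> SW; rewrite mulnC ltnW// -ltn_divLR. Qed.

Lemma arc_step_le (M S W : nat) : (S * W <= M)%N ->
  (S * W * arc_step M S W <= 2 * M)%N.
Proof.
move=> SWM; rewrite mulnS mul2n -addnn leq_add// mulnC; exact: leq_trunc_div.
Qed.

(** For the least [k] that hits, the [k - 1] smaller positive multiples all fail and each adds one
    to [wait]. *)
Lemma wait_hits (M w S W : nat) (z0 : nat -> nat -> nat)
    (t u : {ffun 'I_w -> 'I_M}) :
  (0 < S)%N -> (0 < W)%N -> (0 < w)%N ->
  exists k : nat, [/\ (0 < k <= S * W)%N, (k <= wait S W z0 t u)%N
    & hits S W (k * arc_step M S W) z0 t u].
Proof.
move=> S0 W0 w0; have SW : (0 < S * W)%N by rewrite muln_gt0 S0.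
have hSW : hits S W (S * W * arc_step M S W) z0 t u.
  by apply: hits_full => //; exact: arc_step_ge.
have ex : exists k, (0 < k)%N && hits S W (k * arc_step M S W) z0 t u.
  by exists (S * W)%N; rewrite SW.
case: (ex_minnP ex) => k /andP[k0 hk] kmin; exists k.
have kSW : (k <= S * W)%N by apply: kmin; rewrite SW.
split; rewrite ?k0//.
rewrite /wait (big_cat_nat (n := k)) //=; last by rewrite ltnW.
rewrite addnA; apply: leq_trans (leq_addr _ _).
rewrite (eq_big_nat _ _ (F2 := fun=> 1%N)).
  by rewrite sum_nat_const_nat muln1 subnKC.
move=> l /andP[l0 lk]; case: (boolP (hits _ _ _ _ _ _)) => // hl.
by have := kmin l; rewrite l0 hl leqNgt lk => /(_ isT).
Qed.

(** The sharper bound [4 - 4 * expR (- n / 4)] passes through the induction because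
    [expR (1 / 4) >= 5 / 4]. *)
Lemma sum_expRN_le (R : realType) (n : nat) :
  \sum_(1 <= k < n.+1) expR (- (k%:R / 4)) <= 4 :> R.
Proof.
suff : \sum_(1 <= k < n.+1) expR (- (k%:R / 4)) <= 4 - 4 * expR (- (n%:R / 4))
  :> R.
  by move/le_trans; apply; rewrite gerBl mulr_ge0 ?expR_ge0.
elim: n => [|n IH]; first by rewrite big_geq// mul0r oppr0 expR0; lra.
rewrite big_nat_recr//= (le_trans (lerD IH (lexx _)))//.
have : expR (- (n.+1%:R / 4)) * (1 + 1/4) <= expR (- (n%:R / 4)) :> R.
  rewrite [leRHS](_ : _ = expR (- (n.+1%:R / 4)) * expR (1 / 4)); last first.
    by rewrite -expRD; congr expR; rewrite -(natr1 n); field.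
  by rewrite ler_wpM2l ?expR_ge0// expR_ge1Dx.
lra.
Qed.

(** [1029 = 1 + 4 + 1024]. For [k <= S / 4] the arcs are short enough for [sum_missed_arcs], and
    these bounds add up to at most [4]. For larger [k] a miss is at most as likely as at
    [s = S / 4]; there are at most [S ^ 2] such terms, and [S ^ 2 * expR (- s / 4) <= 1024]. *)
Lemma sum_wait (R : realType) (M w S W : nat) (z0 : nat -> nat -> nat) :
  (0 < W <= S)%N -> (S + W <= w)%N -> (S * W <= M)%N ->
  \sum_(t : {ffun 'I_w -> 'I_M}) \sum_(u : {ffun 'I_w -> 'I_M})
     (wait S W z0 t u)%:R
  <= 1029 * M%:R ^+ (w + w) :> R.
Proof.
move=> /andP[W0 WS] SWw SWM.
have S0 : (0 < S)%N by exact: leq_trans WS.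
have SW0 : (0 < S * W)%N by rewrite muln_gt0 S0.
have M0 : (0 < M)%N by exact: leq_trans SWM.
have M0R : 0 < M%:R :> R by rewrite ltr0n.
set a := arc_step M S W.
pose P k : R := \sum_(t : {ffun 'I_w -> 'I_M}) \sum_(u : {ffun 'I_w -> 'I_M})
     (~~ hits S W (k * a) z0 t u)%:R.
have PS k : (k <= S %/ 4)%N -> P k <= M%:R ^+ (w + w) * expR (- (k%:R / 4)).
  move=> kS; have kS4 : (4 * k <= S)%N by rewrite mulnC -leq_divRL.
  have hM : (2 * W * (k * a) <= M)%N.
    have := arc_step_le SWM; rewrite -/a => h.
    have h4 : (4 * k * (W * a) <= S * (W * a))%N by rewrite leq_mul2r kS4 orbT.
    nia.
  apply: le_trans (sum_missed_arcs R _ M0 W0 SWw hM) _.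
  rewrite ler_wpM2l ?exprn_ge0// ler_expR mulNr lerN2.
  rewrite ler_pdivlMr ?mulr_gt0//.
  have : (M * k)%:R <= (S * W * a * k)%:R :> R.
    by rewrite ler_nat leq_mul2r arc_step_ge// orbT.
  rewrite !natrM; nra.
pose s := (S %/ 4)%N.
have PE k : P k <= M%:R ^+ (w + w) * (expR (- (k%:R / 4)) + expR (- (s%:R /
  4))).
  have [/PS kS|kS] := leqP k s.
    by apply: le_trans kS _; rewrite ler_wpM2l ?exprn_ge0// lerDl expR_ge0.
  apply: le_trans (_ : P s <= _).
    apply: ler_sum => t _; apply: ler_sum => u _; rewrite ler_nat.
    case: (boolP (hits S W (s * a) z0 t u)) => [|_];
      last by case: (hits _ _ _ _ _ _).
    by move/(leq_hits (kap' := k * a)) => ->//; rewrite leq_mul2r ltnW// orbT.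
  apply: le_trans (PS _ (leqnn _)) _.
  by rewrite ler_wpM2l ?exprn_ge0// lerDr expR_ge0.
have -> : \sum_(t : {ffun 'I_w -> 'I_M}) \sum_(u : {ffun 'I_w -> 'I_M})
     (wait S W z0 t u)%:R = M%:R ^+ (w + w) + \sum_(1 <= k < (S * W).+1) P k.
  rewrite /P [X in _ = _ + X]exchange_big /= -[X in X + _]mulr1.
  have -> : M%:R ^+ (w + w) * 1 = \sum_(t : {ffun 'I_w -> 'I_M}) \sum_(u :
    {ffun 'I_w -> 'I_M}) (1 : R).
    by rewrite !sumr_const !card_ffun !card_ord -mulrnA -expnD natrX mulr1.
  rewrite -big_split /=; apply: eq_bigr => t _.
  rewrite [X in _ = _ + X]exchange_big /= -big_split /=; apply: eq_bigr => u _.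
  by rewrite /wait natrD natr_sum.
apply: le_trans (_ : M%:R ^+ (w + w) + \sum_(1 <= k < (S * W).+1)
   (M%:R ^+ (w + w) * (expR (- (k%:R / 4)) + expR (- (s%:R / 4)))) <= _).
  by rewrite lerD2l; apply: ler_sum => k _.
rewrite -mulr_sumr big_split /= sumr_const_nat subSS subn0.
rewrite -{1}[M%:R ^+ _]mulr1 -mulrDr mulrC ler_wpM2r ?exprn_ge0//.
have h1 := sum_expRN_le R (S * W).
suff : expR (- (s%:R / 4)) *+ (S * W) <= 1024 :> R by lra.
rewrite -[leLHS]mulr_natr expRN mulrC ler_pdivrMr ?expR_gt0//.
have : 1 + (s%:R / 4) ^+ 2 / 2 <= expR (s%:R / 4) :> R.
  by apply: (@expR_ge1Dxn R (s%:R / 4) 1); rewrite divr_ge0.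
have : (S * W)%:R <= ((4 * s + 3) * (4 * s + 3))%:R :> R.
  rewrite ler_nat leq_mul//; have := divn_eq S 4;
    have := ltn_pmod S (isT : 0 < 4)%N; rewrite -/s; lia.
rewrite [X in _ <= X -> _]natrM natrD (natrM _ 4); have : 0 <= s%:R :> R by [].
move: (expR _) (S * W)%:R => E X; nra.
Qed.

(** * Squared gaps from test points *)

Lemma natr_ceil (R : realType) (x : R) : 0 <= x ->
  exists c : nat, x <= c%:R < x + 1.
Proof.
move=> x0; have ex : exists c, x <= c%:R :> R.
  by exists (Num.truncn x).+1; exact/ltW/truncnS_gt.
case: (ex_minnP ex) => -[|c] xc cmin; first by exists 0%N; rewrite xc /=; lra.
exists c.+1; rewrite xc -natr1 ltrD2r ltNge.
by apply/negP => /cmin; rewrite ltnn.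
Qed.

Lemma sum_iota_ge (R : realType) (c0 p : nat) (a e : R) :
  a <= c0%:R * e ->
  p%:R * p.+1%:R * e <= 2 * \sum_(c0 <= c < c0 + p) (c%:R * e - a + e).
Proof.
move=> h; elim: p => [|p IH].
  by rewrite addn0 big_geq// !mul0r mulr0.
rewrite addnS big_nat_recr ?leq_addr// [leRHS]mulrDr.
apply: le_trans (lerD IH (lexx _)).
rewrite natrD -!(natr1 p.+1) -!(natr1 p); nra.
Qed.

(* Discrete form of [(b - a)^2 = 2 * \int_a^b (x - a) dx]. *)
Lemma gap_grid (R : realType) (a b : R) (B Q : nat) :
  (0 < Q)%N -> 1 <= a -> a <= b -> b <= B%:R ->
  (b - a) ^+ 2 <= 4 / Q%:R * (\sum_(Q <= c < B * Q)
      ((a <= c%:R / Q%:R) && (c%:R / Q%:R < b))%:R * (c%:R / Q%:R - a +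
        Q%:R^-1))
    + (b - a) / Q%:R.
Proof.
move=> Q0 a1 ab bB; have Q0R : 0 < Q%:R :> R by rewrite ltr0n.
set e : R := Q%:R^-1; have e0 : 0 < e by rewrite invr_gt0.
have eQ : e * Q%:R = 1 by rewrite mulVf// gt_eqF.
have [c0 /andP[ac0 c0a]] : exists c : nat, a * Q%:R <= c%:R < a * Q%:R + 1.
  by apply: natr_ceil; rewrite mulr_ge0//; lra.
have [c1 /andP[bc1 c1b]] : exists c : nat, b * Q%:R <= c%:R < b * Q%:R + 1.
  by apply: natr_ceil; rewrite mulr_ge0//; lra.
have Qc0 : (Q <= c0)%N by rewrite -(ler_nat R); nra.
have c1B : (c1 <= B * Q)%N.
  by rewrite -ltnS -(ltr_nat R) -natr1 natrM; nra.
have c01 : (c0 <= c1)%N by rewrite -ltnS -(ltr_nat R) -natr1; nra.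
have [p c1E] : exists p, c1 = (c0 + p)%N by exists (c1 - c0)%N; rewrite subnKC.
set Sm := \sum_(_ <= _ < _) _.
have T c : 0 <= ((a <= c%:R / Q%:R) && (c%:R / Q%:R < b))%:R
    * (c%:R / Q%:R - a + e).
  by case: andP => [[h _]|_]; rewrite ?mul0r// mul1r addr_ge0 ?subr_ge0// ltW.
have SmE : \sum_(c0 <= c < c0 + p) (c%:R * e - a + e) <= Sm.
  rewrite -c1E /Sm [leRHS](big_cat_nat (n := c0))//= ?(leq_trans c01)//.
  rewrite [X in _ <= _ + X](big_cat_nat (n := c1))//= addrCA.
  rewrite (eq_big_nat _ _ (F2 := fun c => ((a <= c%:R / Q%:R) &&
      (c%:R / Q%:R < b))%:R * (c%:R / Q%:R - a + e))); last first.
    move=> c /andP[c0c cc1].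
    have -> : a <= c%:R / Q%:R.
      by rewrite ler_pdivlMr// (le_trans ac0)// ler_nat.
    have -> : c%:R / Q%:R < b; last by rewrite mul1r.
    rewrite ltr_pdivrMr// -(ltrD2r 1); apply: le_lt_trans c1b.
    by rewrite natr1 ler_nat.
  by rewrite lerDl addr_ge0 ?sumr_ge0.
have ac0' : a <= c0%:R * e by rewrite ler_pdivlMr.
have := le_trans (sum_iota_ge p ac0') (ler_wpM2l _ SmE) => /(_ (ler0n _ _)) h.
have gp : (b - a) < (p%:R + 1) * e.
  rewrite ltr_pdivlMr//; move: bc1 c0a; rewrite c1E natrD; nra.
have -> : 4 / Q%:R = 2 * e * 2 by rewrite /e; field; rewrite gt_eqF.
(* Here [p] is the number of grid points in [[a, b)]. If there is none, the gap is below [1 / Q] and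
   the last term pays for it; otherwise [(p + 1) ^ 2 <= 2 * p * (p + 1)]. *)
have [p0|p0] := posnP p.
  have Sm0 : 0 <= Sm by exact: sumr_ge0.
  have : 0 <= 2 * e * 2 * Sm by rewrite !mulr_ge0// ltW.
  move: gp; rewrite p0 -/e; nra.
have p1 : 1 <= p%:R :> R by rewrite ler1n.
have h2 : 2 * e * (p%:R * p.+1%:R * e) <= 2 * e * (2 * Sm).
  by rewrite ler_wpM2l// mulr_ge0// ltW.
have h3 : (b - a) ^+ 2 <= ((p%:R + 1) * e) ^+ 2.
  by move: gp ab; set y := (p%:R + 1) * e; nra.
have h4 : 0 <= (b - a) / Q%:R by rewrite divr_ge0// subr_ge0.
have h5 : ((p%:R + 1) * e) ^+ 2 <= 2 * e * (p%:R * p.+1%:R * e).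
  have : 0 <= e ^+ 2 * ((p%:R + 1) * (p%:R - 1)).
    by apply: mulr_ge0; [exact: sqr_ge0 | nra].
  by rewrite -natr1; lra.
rewrite -/e in h4; have := le_trans h3 (le_trans h5 h2); lra.
Qed.

(** A test point inside a gap has the lower end of the gap as its closest smaller element, at
    distance at most [V c]. Each test point lies in at most one gap, and the error terms of
    [gap_grid] telescope. *)
Lemma sum_gap_grid (R : realType) (s : seq R) (B Q : nat) (V : nat -> R) :
  sorted <=%R s -> (0 < Q)%N -> {in s, forall d, 1 <= d <= B%:R} ->
  (forall c, 0 <= V c) ->
  (forall c, (Q <= c < B * Q)%N -> (exists2 d, d \in s & d <= c%:R / Q%:R) ->
     exists2 d, d \in s & c%:R / Q%:R - V c <= d <= c%:R / Q%:R) ->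
  \sum_(0 <= i < (size s).-1) (s`_i.+1 - s`_i) ^+ 2
  <= 4 / Q%:R * (\sum_(Q <= c < B * Q) (V c + Q%:R^-1)) + B%:R / Q%:R.
Proof.
move=> ss Q0 sB V0 sV; have Q0R : 0 < Q%:R :> R by rewrite ltr0n.
set e : R := Q%:R^-1; have e0 : 0 < e by rewrite invr_gt0.
have [sz|sz] := leqP (size s) 1.
  rewrite big_geq; last by case: (size s) sz => [|[]].
  rewrite addr_ge0 ?mulr_ge0 ?(ltW e0)// sumr_ge0// => c _.
  by rewrite addr_ge0 ?V0// ltW.
have smono i j : (i <= j)%N -> (j < size s)%N -> s`_i <= s`_j.
  move=> ij js; apply: (sorted_leq_nth le_trans lexx 0 ss) => //.
  by rewrite inE; exact: leq_ltn_trans js.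
have lt_size i : (i < (size s).-1)%N -> (i.+1 < size s)%N.
  by rewrite -ltnS prednK// ltnW.
have sin i : (i < size s)%N -> s`_i \in s by move=> h; exact: mem_nth.
pose I (i c : nat) : R := ((s`_i <= c%:R / Q%:R) && (c%:R / Q%:R < s`_i.+1))%:R.
apply: (@le_trans _ _ (\sum_(0 <= i < (size s).-1)
   (4 / Q%:R * (\sum_(Q <= c < B * Q) I i c * (V c + e)) + (s`_i.+1 - s`_i) /
     Q%:R))).
  apply: ler_sum_nat => i /andP[_ /lt_size is1].
  have i0 := ltnW is1.
  have /andP[si1 _] := sB _ (sin _ i0).
  have /andP[_ siB] := sB _ (sin _ is1).
  apply: le_trans (gap_grid Q0 si1 (smono _ _ (leqnSn i) is1) siB) _.
  rewrite lerD2r ler_wpM2l ?divr_ge0//; apply: ler_sum_nat => c cQ.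
  rewrite /I; case: (boolP (_ && _)) => [/andP[ac cb]|]; last by rewrite !mul0r.
  rewrite !mul1r lerD2r; have [||d ds /andP[dV dc]] := sV c => //.
    by exists s`_i => //; exact: sin.
  have : d <= s`_i.
    rewrite leNgt; apply/negP => sd.
    have ds' : (index d s < size s)%N by rewrite index_mem.
    have dE : s`_(index d s) = d by rewrite nth_index.
    have [ji|ij] := leqP (index d s) i.
      by have := smono _ _ ji i0; rewrite dE leNgt sd.
    by have := smono _ _ ij ds'; rewrite dE; move: (le_lt_trans dc cb); lra.
  lra.
rewrite big_split /= -mulr_sumr -mulr_suml telescope_sumr//.
rewrite exchange_big /=; apply: lerD.
  rewrite ler_wpM2l ?divr_ge0//; apply: ler_sum_nat => c _.
  rewrite -mulr_suml ler_piMl ?addr_ge0 ?V0//; first exact: ltW.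
  (* [I i c] is [f i - f i.+1], so its sum over the gaps telescopes to at most one. *)
  pose f (i : nat) : R := (s`_i <= c%:R / Q%:R)%R%:R.
  rewrite (eq_big_nat _ _ (F2 := fun i => - f i.+1 - - f i)); last first.
    move=> i /andP[_ /lt_size is1]; rewrite /I /f opprK addrC ltNge.
    case: (boolP (s`_i.+1 <= _)) => h; last by rewrite andbT subr0.
    by rewrite (le_trans (smono _ _ (leqnSn i) is1) h) /= subrr.
  rewrite telescope_sumr// opprK /f addrC lerBlDr.
  by case: (s`_0 <= _)%R; case: (s`_(size s).-1 <= _)%R; rewrite /=; lra.
rewrite ler_wpM2r ?invr_ge0//.
have /andP[_ h1] : 1 <= s`_(size s).-1 <= B%:R.
  by apply/sB/sin; rewrite prednK// ltnW.
have /andP[h2 _] := sB _ (sin 0%N (ltnW sz)).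
lra.
Qed.

(** * Chords of concentric circles *)

Lemma sin_MVT (R : realType) (x y : R) : x <= y ->
  exists2 c, c \in `[x, y] & sin y - sin x = cos c * (y - x).
Proof.
move=> xy; apply: MVT_segment => //.
by apply: (@continuous_subspaceT R R); exact: continuous_sin.
Qed.

Lemma ler_norm_sinB (R : realType) (x y : R) : `|sin y - sin x| <= `|y - x|.
Proof.
wlog xy : x y / x <= y => [hw|].
  by have [/hw//|/ltW/hw] := leP x y; rewrite distrC [leRHS]distrC.
have [c _ ->] := sin_MVT xy.
by rewrite normrM ler_piMl// ler_norml cos_geN1 cos_le1.
Qed.

Lemma ler_norm_cosB (R : realType) (x y : R) : `|cos y - cos x| <= `|y - x|.
Proof.
rewrite -!sinDpihalf; apply: le_trans (ler_norm_sinB _ _) _.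
by rewrite opprD addrACA subrr addr0.
Qed.

Lemma ge_cos (R : realType) (x y : R) :
  0 <= x -> x <= y -> y <= pi -> cos y <= cos x.
Proof.
move=> x0; rewrite le_eqVlt => /predU1P[->//|xy] ypi.
by rewrite ltW// ltr_cos// in_itv /=; lra.
Qed.

Lemma cos_half (R : realType) (x : R) :
  cos x = cos (x / 2) ^+ 2 - sin (x / 2) ^+ 2.
Proof. by rewrite {1}(splitr x) cosD. Qed.

(** By the mean value theorem [sin (y / 2) >= (y / 2) * cos (y / 2)], so the double-angle formula
    gives [sin y >= y * cos (y / 2) ^ 2], and [cos y >= 0] makes the squared cosine at least
    [1 / 2]. *)
Lemma sin_ge_half (R : realType) (y : R) : 0 <= y <= pi / 2 -> y / 2 <= sin y.
Proof.
move=> /andP[y0 ypi]; have pi2 := pi_ge2 R.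
have y2 : 0 <= y / 2 by rewrite divr_ge0.
have [c cy] := sin_MVT y2.
rewrite sin0 !subr0 => sE; move: cy; rewrite in_itv /= => /andP[c0 cy].
have cc : cos (y / 2) <= cos c by apply: ge_cos; lra.
have cy0 : 0 <= cos (y / 2) by apply: cos_ge0_pihalf; lra.
have cosy : 0 <= cos y by apply: cos_ge0_pihalf; lra.
have -> : sin y = 2 * (sin (y / 2) * cos (y / 2)).
  by rewrite {1}(splitr y) sinD; ring.
have : cos y = 2 * cos (y / 2) ^+ 2 - 1.
  rewrite [cos y]cos_half; have := cos2Dsin2 (y / 2); lra.
rewrite sE; move: (cos c) (cos (y / 2)) cc cy0 => u v uv v0 yE.
have v2 : 1 / 2 <= v ^+ 2 by lra.
have : v ^+ 2 <= u * v by rewrite expr2 ler_wpM2r.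
have : 0 <= y by []. nra.
Qed.

Lemma sin_ge_itv (R : realType) (e y : R) : 0 <= e <= pi / 2 ->
  e <= y <= pi - e -> e / 2 <= sin y.
Proof.
move=> /andP[e0 epi] /andP[ey ye].
have [yp|yp] := leP y (pi / 2).
  have : y / 2 <= sin y by apply: sin_ge_half; lra.
  lra.
have : (pi - y) / 2 <= sin (pi - y) by apply: sin_ge_half; lra.
rewrite sinB sinpi cospi; lra.
Qed.

Definition polar (R : realType) (a x : R) : 'rV[R]_2 :=
  \row_k (if k == 0 then a * cos x else a * sin x).

Definition chord (R : realType) (a b x : R) : R :=
  Num.sqrt (a ^+ 2 + b ^+ 2 - 2 * a * b * cos x).

Lemma edist_polar (R : realType) (a b x y : R) :
  edist (polar a x) (polar b y) = chord a b (x - y).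
Proof.
rewrite /edist /chord !big_ord_recl big_ord0 !mxE /= cosB; congr Num.sqrt.
have := cos2Dsin2 x; have := cos2Dsin2 y.
move: (cos x) (cos y) (sin x) (sin y) => c d s t h1 h2.
have -> : a ^+ 2 = a ^+ 2 * (c ^+ 2 + s ^+ 2) by rewrite h2 mulr1.
have -> : b ^+ 2 = b ^+ 2 * (d ^+ 2 + t ^+ 2) by rewrite h1 mulr1.
ring.
Qed.

Lemma chordD2pi (R : realType) (a b x : R) (n : nat) :
  chord a b (x + pi *+ 2 *+ n) = chord a b x.
Proof. by rewrite /chord (periodicn (@cosD2pi R)). Qed.

Lemma chord_ge0 (R : realType) (a b x : R) : 0 <= chord a b x.
Proof. exact: sqrtr_ge0. Qed.

Lemma chord_radicand_ge0 (R : realType) (a b x : R) : 0 <= a -> 0 <= b ->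
  0 <= a ^+ 2 + b ^+ 2 - 2 * a * b * cos x.
Proof.
move=> a0 b0; have := cos_le1 x; have : 0 <= a * b by rewrite mulr_ge0.
have := sqr_ge0 (a - b); move: (cos x) => c; nra.
Qed.

Lemma chord_near (R : realType) (a b x : R) : 0 <= a -> 0 <= b ->
  chord a b x ^+ 2 = (a - b) ^+ 2 + 4 * a * b * sin (x / 2) ^+ 2.
Proof.
move=> a0 b0; rewrite sqr_sqrtr ?chord_radicand_ge0//.
have := cos2Dsin2 (x / 2); rewrite [cos x]cos_half.
move: (cos (x / 2)) (sin (x / 2)) => c s h.
have : a * b = a * b * (c ^+ 2 + s ^+ 2) by rewrite h mulr1.
lra.
Qed.

Lemma chord_far (R : realType) (a b x : R) : 0 <= a -> 0 <= b ->
  chord a b x ^+ 2 = (a + b) ^+ 2 - 4 * a * b * cos (x / 2) ^+ 2.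
Proof.
move=> a0 b0; rewrite chord_near//; have := cos2Dsin2 (x / 2).
move: (cos (x / 2)) (sin (x / 2)) => c s h.
have : a * b = a * b * (c ^+ 2 + s ^+ 2) by rewrite h mulr1.
lra.
Qed.

Lemma chord_le (R : realType) (a b x : R) : 0 <= a -> 0 <= b ->
  chord a b x <= a + b.
Proof.
move=> a0 b0; rewrite -(ler_pXn2r (n := 2))// ?nnegrE ?addr_ge0 ?chord_ge0//.
rewrite chord_far// gerBl; apply: mulr_ge0; last exact: sqr_ge0.
by rewrite !mulr_ge0.
Qed.

Lemma chord_ge (R : realType) (a b x : R) : 0 <= a -> 0 <= b ->
  `|a - b| <= chord a b x.
Proof.
move=> a0 b0; rewrite -(ler_pXn2r (n := 2))// ?nnegrE ?chord_ge0//.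
rewrite chord_near// real_normK ?num_real// lerDl; apply: mulr_ge0;
  last exact: sqr_ge0.
by rewrite !mulr_ge0.
Qed.

Lemma chord_ge_angle (R : realType) (a e x : R) : 0 <= a -> 0 <= e <= pi / 2 ->
  2 * e <= x <= 2 * pi - 2 * e -> a * e <= chord a a x.
Proof.
move=> a0 e0 xe; have es : e / 2 <= sin (x / 2).
  by apply: sin_ge_itv => //; lra.
have ae : 0 <= a * e by apply: mulr_ge0 => //; lra.
rewrite -(ler_pXn2r (n := 2))// ?nnegrE ?chord_ge0//.
rewrite chord_near// subrr expr0n add0r.
have : (a * (e / 2)) ^+ 2 <= (a * sin (x / 2)) ^+ 2.
  rewrite ler_pXn2r// ?nnegrE; first by rewrite ler_wpM2l.
    by rewrite mulr_ge0//; lra.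
  by rewrite mulr_ge0//; lra.
lra.
Qed.

Definition chord_angle (R : realType) (a b y : R) : R :=
  acos ((a ^+ 2 + b ^+ 2 - y ^+ 2) / (2 * a * b)).

Lemma chord_angleP (R : realType) (a b y : R) : 0 < a -> 0 < b ->
  `|a - b| <= y <= a + b ->
  0 <= chord_angle a b y <= pi /\ chord a b (chord_angle a b y) = y.
Proof.
move=> a0 b0 /andP[y1 y2]; have ab : 0 < 2 * a * b by rewrite !mulr_gt0.
have y0 : 0 <= y by apply: le_trans y1.
have y1' : (a - b) ^+ 2 <= y ^+ 2.
  by rewrite -[leLHS]real_normK ?num_real// ler_pXn2r ?nnegrE.
have y2' : y ^+ 2 <= (a + b) ^+ 2 by rewrite ler_pXn2r ?nnegrE// addr_ge0 ?ltW.
rewrite /chord_angle; set c := (_ / _).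
have [|xpi cE] := @acos_def R c.
  by rewrite ler_pdivlMr// ler_pdivrMr//; lra.
split=> //; rewrite /chord cE /c mulrC divfK ?gt_eqF//.
by rewrite opprB addrC subrK sqrtr_sqr ger0_norm.
Qed.

Lemma ler_chord (R : realType) (a b x y : R) : 0 <= a -> 0 <= b ->
  0 <= x -> x <= y -> y <= pi -> chord a b x <= chord a b y.
Proof.
move=> a0 b0 x0 xy ypi; rewrite ler_sqrt ?chord_radicand_ge0//.
by rewrite lerD2l lerN2 ler_wpM2l ?mulr_ge0// ge_cos.
Qed.

(** From [chord ^ 2 >= 4 a b sin (x / 2) ^ 2] follows [2 a b sin (x / 2) <= r * chord]. The
    difference of the squared chords factors through the half-angle sines, which bounds the slope
    without differentiating the square root. *)
Lemma chord_lipschitz (R : realType) (r a b x y : R) : 0 < a <= r -> 0 < b <=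
  r ->
  0 <= x -> x <= y -> y <= pi -> chord a b y - chord a b x <= r * (y - x).
Proof.
move=> /andP[a0 ar] /andP[b0 br] x0 xy ypi.
have F (x' : R) : 0 <= x' <= pi -> 0 <= sin (x' / 2) /\
    2 * a * b * sin (x' / 2) <= r * chord a b x'.
  move=> x'pi; have s0 : 0 <= sin (x' / 2) by apply: sin_ge0_pi; lra.
  split => //; rewrite -(ler_pXn2r (n := 2))// ?nnegrE; last 2 first.
  - by rewrite !mulr_ge0// ltW.
  - by rewrite mulr_ge0 ?chord_ge0//; lra.
  rewrite !exprMn (chord_near _ (ltW a0) (ltW b0)).
  have ab : a * b <= r * r by rewrite ler_pM// ltW.
  have : (a * b) * (a * b * sin (x' / 2) ^+ 2) <= (r * r) * (a * b * sin (x' /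
    2) ^+ 2).
    by apply: ler_wpM2r => //; apply: mulr_ge0 (sqr_ge0 _);
      rewrite mulr_ge0 ?ltW.
  have : 0 <= (r * (a - b)) ^+ 2 by rewrite sqr_ge0.
  by move: (sin _) => s; lra.
have [s1 h1] := F x ltac:(lra); have [s2 h2] := F y ltac:(lra).
have sxy : sin (y / 2) - sin (x / 2) <= (y - x) / 2.
  apply: le_trans (ler_norm _) _; apply: le_trans (ler_norm_sinB _ _) _.
  by rewrite ger0_norm; lra.
have Fxy := ler_chord (ltW a0) (ltW b0) x0 xy ypi.
have E : chord a b y ^+ 2 - chord a b x ^+ 2 =
    4 * a * b * (sin (y / 2) - sin (x / 2)) * (sin (y / 2) + sin (x / 2)).
  by rewrite !(chord_near _ (ltW a0) (ltW b0)); ring.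
have [Fy|Fy] := eqVneq (chord a b y) 0.
  have := chord_ge0 a b x; rewrite Fy;
    have : 0 <= r * (y - x) by rewrite mulr_ge0//; lra.
  lra.
have Fs : 0 < chord a b y + chord a b x.
  by rewrite ltr_pwDl ?chord_ge0// lt_neqAle eq_sym Fy chord_ge0.
rewrite -(ler_pM2r Fs).
have h3 : 2 * a * b * (sin (y / 2) + sin (x / 2)) <= r * (chord a b y + chord
  a b x) by lra.
have : (y - x) * (2 * a * b * (sin (y / 2) + sin (x / 2))) <=
  (y - x) * (r * (chord a b y + chord a b x)) by rewrite ler_wpM2l// subr_ge0.
have : (2 * a * b * (sin (y / 2) + sin (x / 2))) * (2 * (sin (y / 2) - sin (x
  / 2))) <=
  (2 * a * b * (sin (y / 2) + sin (x / 2))) * (y - x).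
  apply: ler_wpM2l; last lra.
  by rewrite !mulr_ge0 ?addr_ge0 ?(ltW a0) ?(ltW b0).
lra.
Qed.

(* Near the diameter the chord is flat: [4 a b cos^2 (x / 2)] is what is missing
   from [(a + b)^2], so the slope is controlled
     by the square root of the depth. *)
Lemma chord_lipschitz_far (R : realType) (r a b x y : R) :
  0 < a <= r -> 0 < b <= r -> 0 <= x -> x <= y -> y <= pi ->
  r <= chord a b x ->
  chord a b y - chord a b x
    <= Num.sqrt ((2 * r) ^+ 2 - chord a b x ^+ 2) * (y - x).
Proof.
move=> /andP[a0 ar] /andP[b0 br] x0 xy ypi rF.
have r0 : 0 < r by exact: lt_le_trans ar.
have c1 : 0 <= cos (y / 2) by apply: cos_ge0_pihalf; lra.
have c2 : cos (y / 2) <= cos (x / 2) by apply: ge_cos; lra.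
have cxy : cos (x / 2) - cos (y / 2) <= (y - x) / 2.
  apply: le_trans (ler_norm _) _; apply: le_trans (ler_norm_cosB _ _) _.
  by rewrite distrC ger0_norm; lra.
have Fxy := ler_chord (ltW a0) (ltW b0) x0 xy ypi.
have E : chord a b y ^+ 2 - chord a b x ^+ 2 =
    4 * a * b * (cos (x / 2) - cos (y / 2)) * (cos (x / 2) + cos (y / 2)).
  by rewrite !(chord_far _ (ltW a0) (ltW b0)); ring.
have ab : 0 <= a * b by rewrite mulr_ge0 ?ltW.
set q := Num.sqrt _; have q0 : 0 <= q by exact: sqrtr_ge0.
have hq : 2 * a * b * cos (x / 2) <= r * q.
  rewrite -(ler_pXn2r (n := 2))// ?nnegrE; last 2 first.
  - by rewrite !mulr_ge0 ?(ltW a0) ?(ltW b0) //; lra.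
  - by rewrite mulr_ge0// ltW.
  have ab2 : a * b <= r * r by rewrite ler_pM// ltW.
  have ab3 : (a + b) ^+ 2 <= (2 * r) ^+ 2.
    by rewrite ler_pXn2r// ?nnegrE; lra.
  have Fab : chord a b x ^+ 2 <= (2 * r) ^+ 2.
    apply: le_trans ab3; rewrite ler_pXn2r ?nnegrE ?chord_ge0//.
      exact: chord_le (ltW a0) (ltW b0).
    exact: addr_ge0 (ltW a0) (ltW b0).
  rewrite [leRHS]exprMn sqr_sqrtr ?subr_ge0// (chord_far _ (ltW a0) (ltW b0)).
  have : (a * b) * (a * b * cos (x / 2) ^+ 2) <= (r * r) * (a * b * cos (x /
    2) ^+ 2).
    by apply: ler_wpM2r => //; apply: mulr_ge0 (sqr_ge0 _);
      rewrite mulr_ge0 ?ltW.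
  have : 0 <= r ^+ 2 * ((2 * r) ^+ 2 - (a + b) ^+ 2).
    by apply: mulr_ge0; rewrite ?sqr_ge0 ?subr_ge0.
  lra.
have Fs : 0 < chord a b y + chord a b x by lra.
rewrite -(ler_pM2r Fs).
have : 4 * (a * b) * (cos (x / 2) - cos (y / 2)) * (cos (x / 2) + cos (y / 2))
    <= 4 * (a * b) * ((y - x) / 2) * (2 * cos (x / 2)).
  apply: ler_pM; [|lra|rewrite ler_wpM2l//|lra].
    by rewrite !mulr_ge0//; lra.
  by rewrite mulr_ge0.
have : (y - x) * (2 * a * b * cos (x / 2)) <= (y - x) * (r * q).
  by rewrite ler_wpM2l// subr_ge0.
have : q * (y - x) * (2 * r) <= q * (y - x) * (chord a b y + chord a b x).
  by rewrite ler_wpM2l ?mulr_ge0// ?subr_ge0//; lra.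
lra.
Qed.

(** * The configuration *)

(** Unit of the random shifts: [M] units make [2 pi / m ^ 2], the mesh of the angle differences
    between the two families. *)
Definition fine_angle (R : realType) (m M : nat) : R :=
  2 * pi / (m%:R ^+ 2 * M%:R).

(** Mesh realised by the two opposite arcs of the outermost circle; [m ^ 2] units span [pi / 4]. *)
Definition top_angle (R : realType) (m : nat) : R := pi / (4 * m%:R ^+ 2).

(* Points are laid out row by row, [m] per row: the first four rows are on the
   outermost circle, row [4 + j] is on the circle of radius [16 * m - 1 - j]
   (the subtraction [k %/ m - 3] is truncated). *)
Definition row_radius (m k : nat) : nat := (16 * m - (k %/ m - 3))%N.

(** Progressions with steps [m] and [m - 1] face each other twice: rows 0 to 2 against row 3, in
    units of [top_angle], and even against odd rows from row 4 on, in units of [2 pi / m ^ 2]. Up to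
    the shifts, division by [m] with remainder shows that the differences reach all the multiples
    needed. *)
Definition row_angle (R : realType) (m M : nat) (t u : nat -> nat) (k : nat)
    : R :=
  let r := (k %/ m)%N in let c := (k %% m)%N in
  if (r < 3)%N then (k * m)%:R * top_angle R m
  else if r == 3%N then pi + (m * m + c * m.-1)%:R * top_angle R m
  else if odd r then (c * m.-1 * M + u ((r - 4)./2))%:R * fine_angle R m M
  else (c * m * M + t ((r - 4)./2))%:R * fine_angle R m M.

Definition config (R : realType) (m M : nat) (t u : nat -> nat) (k : nat)
    : 'rV[R]_2 :=
  polar (row_radius m k)%:R (row_angle R m M t u k).

Lemma config_dist (R : realType) (m M : nat) (t u : nat -> nat) (k l : nat) :
  edist (config R m M t u k) (config R m M t u l) =
  chord (row_radius m k)%:R (row_radius m l)%:R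
    (row_angle R m M t u k - row_angle R m M t u l).
Proof. exact: edist_polar. Qed.

Lemma config_dist_le (R : realType) (m M : nat) (t u : nat -> nat) (k l : nat) :
  edist (config R m M t u k) (config R m M t u l) <= (32 * m)%:R.
Proof.
rewrite config_dist; apply: le_trans (chord_le _ _ _) _ => //.
rewrite -natrD ler_nat /row_radius; lia.
Qed.

(** Distinct circles have distinct integer radii. Two points of one circle, whose radius is at least
    [8 * m], are separated by [chord_ge_angle] once their angles differ by at least [2 * e] both
    ways round with [r * e >= 1]. *)
Lemma config_sep (R : realType) (m M : nat) (t u : nat -> nat) (k l : nat) :
  (1 < m)%N -> (0 < M)%N -> (k %/ m <= 8 * m)%N -> (l < k)%N ->
  1 <= edist (config R m M t u k) (config R m M t u l).
Proof.
move=> m1 M0 km lk; rewrite config_dist.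
have m0 : (0 < m)%N by exact: ltnW.
have m2R : 2 <= m%:R :> R by rewrite ler_nat.
have m0R : 0 < m%:R :> R by lra.
have M0R : 0 < M%:R :> R by rewrite ltr0n.
have pi2 := pi_ge2 R.
have rlk : (l %/ m <= k %/ m)%N by rewrite leq_div2r// ltnW.
have [rE|rE] := eqVneq (row_radius m k) (row_radius m l); last first.
  apply: le_trans (chord_ge _ (ler0n _ _) (ler0n _ _)).
  rewrite distrC ger0_norm; last by rewrite subr_ge0 ler_nat /row_radius; lia.
  by rewrite lerBrDr nat1r ler_nat; rewrite /row_radius in rE *; lia.
have ckl : (k = (k %/ m) * m + k %% m)%N by exact: divn_eq.
have cll : (l = (l %/ m) * m + l %% m)%N by exact: divn_eq.
have ck := ltn_pmod k m0; have cl := ltn_pmod l m0.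
rewrite -rE; set r : R := (row_radius m k)%:R.
have r8 : 8 * m%:R <= r.
  rewrite -natrM ler_nat /row_radius; lia.
suff [e [e1 e2 e3]] : exists e, [/\ 0 <= e <= pi / 2, 1 <= r * e &
    2 * e <= row_angle R m M t u k - row_angle R m M t u l <= 2 * pi - 2 * e].
  by apply: le_trans (chord_ge_angle _ _ e3) => //; rewrite ler0n.
have m1E : m.-1%:R = m%:R - 1 :> R by rewrite -subn1 natrB.
have spaced (d : nat) (a : R) : (0 < d < m)%N -> pi / m%:R <= a <= 2 * pi /
  m%:R ->
  exists e, [/\ 0 <= e <= pi / 2,
    1 <= r * e & 2 * e <= d%:R * a <= 2 * pi - 2 * e].
  move=> /andP[d0 dm]; rewrite ler_pdivrMr// ler_pdivlMr// => /andP[a1 a2].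
  have d1 : 1 <= d%:R :> R by rewrite ler1n.
  have dm1 : d%:R + 1 <= m%:R :> R by rewrite natr1 ler_nat.
  exists (a / 2); split; [apply/andP; split; nra|nra|apply/andP; split; nra].
have eta0 : top_angle R m * (4 * m%:R ^+ 2) = pi.
  by rewrite /top_angle divfK// gt_eqF// mulr_gt0 ?exprn_gt0.
have gam0 : fine_angle R m M * M%:R * m%:R ^+ 2 = 2 * pi.
  by rewrite -mulrA [M%:R * _]mulrC /fine_angle divfK// gt_eqF// mulr_gt0
    ?exprn_gt0.
rewrite /row_angle; have [k4|k3] := leqP 4 (k %/ m).
  have lr : (l %/ m = k %/ m)%N by rewrite /row_radius in rE; lia.
  have dP : (0 < k %% m - l %% m < m)%N by rewrite lr in cll; apply/andP;
    split; lia.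
  have dE : (k %% m - l %% m)%:R = (k %% m)%:R - (l %% m)%:R :> R.
    by rewrite natrB//; lia.
  have -> : (k %/ m < 3)%N = false by lia.
  have -> : (l %/ m < 3)%N = false by lia.
  rewrite lr gtn_eqF ?(leq_trans _ k4)//; set g := fine_angle R m M in gam0 *.
  have gM : pi / m%:R = g * M%:R * m%:R / 2
    by rewrite -(mulfK (lt0r_neq0 m0R) (g * M%:R * m%:R / 2)); congr (_ / _);
      lra.
  have gM2 : 2 * pi / m%:R = g * M%:R * m%:R by lra.
  have gM0 : 0 <= g * M%:R by have := pi_ge0 R; nra.
  case: ifP => _.
    have [|e [e1 e2 e3]] := spaced _ (g * M%:R * m.-1%:R) dP.
      by rewrite gM gM2 m1E; apply/andP; split; nra.
    exists e; split => //; move: e3; rewrite dE !natrD !natrM.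
    by rewrite (_ : _ * g -
      _ * g = ((k %% m)%:R - (l %% m)%:R) * (g * M%:R * m.-1%:R))//; ring.
  have [|e [e1 e2 e3]] := spaced _ (g * M%:R * m%:R) dP.
    by rewrite gM gM2; apply/andP; split; nra.
  exists e; split => //; move: e3; rewrite dE !natrD !natrM.
  by rewrite (_ : _ * g -
    _ * g = ((k %% m)%:R - (l %% m)%:R) * (g * M%:R * m%:R))//; ring.
have rE16 : r = 16 * m%:R by rewrite -natrM /r /row_radius; congr _%:R; lia.
set h := top_angle R m in eta0 *.
have h0 : 0 <= h.
  by apply: divr_ge0; [exact: pi_ge0 | rewrite mulr_ge0 ?sqr_ge0].
have [x xE] : {x | x = m%:R * h} by exists (m%:R * h).
have x0 : 0 <= x by rewrite xE mulr_ge0.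
have xm : 4 * (m%:R * x) = pi by rewrite -eta0 xE; ring.
have xm2 : 2 * x <= m%:R * x by rewrite ler_wpM2r.
have [kr3|kr3] := ltnP (k %/ m) 3.
  have -> : (l %/ m < 3)%N by exact: leq_ltn_trans rlk kr3.
  have k3m : (k < 3 * m)%N by rewrite -ltn_divLR.
  have kl1 : 1 <= k%:R - l%:R :> R by rewrite -natrB ?ler1n ?subn_gt0// ltnW.
  have kl2 : k%:R - l%:R + 1 <= 3 * m%:R :> R.
    rewrite -natrM -natrB 1?ltnW// natr1 ler_nat.
    exact: leq_ltn_trans (leq_subr _ _) k3m.
  have -> : (k * m)%:R * h - (l * m)%:R * h = (k%:R - l%:R) * x.
    by rewrite !natrM xE; ring.
  have p1 : 1 * x <= (k%:R - l%:R) * x by rewrite ler_wpM2r.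
  have p2 : (k%:R - l%:R + 1) * x <= (3 * m%:R) * x by rewrite ler_wpM2r.
  exists (x / 2); rewrite rE16; split; [apply/andP; split; lra|lra|].
  apply/andP; split; lra.
have {}kr3 : (k %/ m = 3)%N by apply/eqP; rewrite eqn_leq -ltnS k3.
rewrite kr3 /=; have ckR : (k %% m)%:R + 1 <= m%:R :> R
  by rewrite natr1 ler_nat.
have xE' c : (m * m + c * m.-1)%:R * h = m%:R * x + c%:R * (x - h).
  by rewrite natrD !natrM m1E xE; ring.
have xh : h <= x / 2 by rewrite xE; nra.
have [lr3|lr3] := ltnP (l %/ m) 3.
  have l3m : l%:R <= 3 * m%:R :> R by rewrite -natrM ler_nat ltnW// -ltn_divLR.
  have p1 : l%:R * x <= (3 * m%:R) * x by rewrite ler_wpM2r.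
  have p2 : 0 <= l%:R * x by rewrite mulr_ge0.
  have p3 : (k %% m)%:R * (x - h) <= m%:R * (x - h) by apply: ler_wpM2r; lra.
  have p4 : 0 <= (k %% m)%:R * (x - h) by apply: mulr_ge0 => //; lra.
  have p5 : 0 <= m%:R * h by rewrite mulr_ge0.
  have -> : (l * m)%:R * h = l%:R * x by rewrite natrM xE; ring.
  (* Rows 0 to 2 stay within [[0, 3 pi / 4]] and row 3 within [[5 pi / 4, 3 pi / 2]], so these
     angles differ by between [pi / 2] and [3 pi / 2]. *)
  rewrite xE'; exists (pi / 4); rewrite rE16; split; [apply/andP; split;
    lra|nra|].
  apply/andP; split; lra.
have {}lr3 : (l %/ m = 3)%N by apply/eqP;
  rewrite eqn_leq lr3 -[X in (_ <= X)%N]kr3 rlk.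
rewrite lr3 /=; rewrite kr3 in ckl; rewrite lr3 in cll.
have lkm : (l %% m < k %% m)%N by rewrite -(ltn_add2l (3 * m)) -cll -ckl.
have kl1 : 1 <= (k %% m)%:R - (l %% m)%:R :> R.
  by rewrite -natrB ?ler1n ?subn_gt0// ltnW.
have kl2 : (k %% m)%:R - (l %% m)%:R + 1 <= m%:R :> R.
  have l0 : 0 <= (l %% m)%:R :> R by []; lra.
rewrite !xE'.
have p1 : 1 * (x - h) <= ((k %% m)%:R - (l %% m)%:R) * (x - h).
  by apply: ler_wpM2r; lra.
have p2 : ((k %% m)%:R - (l %% m)%:R + 1) * (x - h) <= m%:R * (x - h).
  by apply: ler_wpM2r; lra.
have p3 : 0 <= m%:R * h by rewrite mulr_ge0.
have p4 : m%:R * h <= m%:R * (x / 2) by rewrite ler_wpM2l.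
exists ((x - h) / 2); rewrite rE16; split; [apply/andP; split; lra|lra|].
apply/andP; split; lra.
Qed.

(** Every [p] is congruent to [c * m - c' * (m - 1)] modulo [m ^ 2]: write [p = q * m + c'] and
    reduce [q + c'] modulo [m] to get [c]. The quotient [e] of that reduction counts full turns. *)
Lemma config_pair (R : realType) (m M w : nat) (t u : nat -> nat)
    (i j z : nat) :
  (0 < m)%N -> (0 < M)%N -> (t i < M)%N -> (i < w)%N -> (j < w)%N ->
  t i = z + u j %[mod M] ->
  exists k l, [/\ (k < (4 + 2 * w) * m)%N, (l < (4 + 2 * w) * m)%N, k != l &
    edist (config R m M t u k) (config R m M t u l) =
    chord (16 * m - (1 + 2 * i))%:R (16 * m - (2 + 2 * j))%:R
      (z%:R * fine_angle R m M)].
Proof.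
move=> m0 M0 tM iw jw; rewrite modn_small// => tE.
pose p := ((z + u j) %/ M)%N.
have pE : (z + u j = p * M + t i)%N by rewrite {1}(divn_eq (z + u j) M) -tE.
pose c' := (p %% m)%N; pose q := (p %/ m)%N.
pose c := ((q + c') %% m)%N; pose e := ((q + c') %/ m)%N.
have cm : (c < m)%N by exact: ltn_pmod.
have cm' : (c' < m)%N by exact: ltn_pmod.
exists ((4 + 2 * i) * m + c)%N, ((5 + 2 * j) * m + c')%N; split.
- by rewrite -ltn_divLR// divnMDl// divn_small// addn0 ltn_add2l ltn_mul2l.
- rewrite -ltn_divLR// divnMDl// divn_small// addn0; lia.
- apply/eqP => /(congr1 (divn^~ m)); rewrite !divnMDl// !divn_small//; lia.
rewrite config_dist /row_radius /row_angle !divnMDl// !modnMDl !(divn_small cm)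
  !(divn_small cm') !(modn_small cm) !(modn_small cm') !addn0.
have -> : (4 + 2 * i - 3 = 1 + 2 * i)%N by lia.
have -> : (5 + 2 * j - 3 = 2 + 2 * j)%N by lia.
have -> : (4 + 2 * i - 4 = i.*2)%N by lia.
have -> : (5 + 2 * j - 4 = j.*2.+1)%N by lia.
have -> : (4 + 2 * i < 3)%N = false by [].
have -> : (5 + 2 * j < 3)%N = false by [].
have -> : (4 + 2 * i == 3)%N = false by [].
have -> : (5 + 2 * j == 3)%N = false by [].
have -> : odd (4 + 2 * i) = false by rewrite oddD mul2n odd_double.
have -> : odd (5 + 2 * j) = true by rewrite oddD mul2n odd_double.
rewrite doubleK [(_.+1)./2]uphalf_double.
rewrite -(chordD2pi _ _ _ e); congr chord.
have g0 : fine_angle R m M * (m%:R ^+ 2 * M%:R) = 2 * pi.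
  by rewrite /fine_angle divfK// gt_eqF// mulr_gt0 ?exprn_gt0 ?ltr0n.
rewrite -mulrnA -[pi *+ _]mulr_natr natrM.
have -> : pi * (2 * e%:R) = e%:R * (fine_angle R m M * (m%:R ^+ 2 * M%:R)) :> R.
  by rewrite g0; ring.
have key : (c * m * M + t i + e * m ^ 2 * M = z + (c' * m.-1 * M + u j))%N.
  rewrite addnCA pE addnA addnAC; congr (_ + _)%N.
  rewrite -!mulnDl; congr (_ * _)%N.
  have h1 : (q + c' = e * m + c)%N by exact: divn_eq.
  have h2 : (p = q * m + c')%N by exact: divn_eq.
  have h3 : (c' * m.-1 + c' = c' * m)%N
    by rewrite -[in RHS](prednK m0) mulnS addnC.
  have h4 : (c * m + e * m ^ 2 = (q + c') * m)%N by rewrite h1; lia.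
  by rewrite h4 h2 mulnDl -h3; lia.
have := congr1 (fun x : nat => x%:R * fine_angle R m M) key.
rewrite /= !natrD !natrM; lra.
Qed.

(** The same division [y = q * m + c'] works without reduction, because rows 0 to 2 have room for
    the index [q + m + c' < 3 * m]; its offset [m] is cancelled by the [m * m] of row 3. *)
Lemma config_top (R : realType) (m M : nat) (t u : nat -> nat) (y : nat) :
  (0 < m)%N -> (y < m * m)%N ->
  exists k l, [/\ (k < 4 * m)%N, (l < 4 * m)%N, k != l &
    edist (config R m M t u k) (config R m M t u l) =
    chord (16 * m)%:R (16 * m)%:R (pi - y%:R * top_angle R m)].
Proof.
move=> m0 ym.
pose c' := (y %% m)%N; pose q := (y %/ m)%N.
have cm' : (c' < m)%N by exact: ltn_pmod.
have qm : (q < m)%N by rewrite ltn_divLR.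
have kr : ((q + m + c') %/ m < 3)%N by rewrite ltn_divLR//; lia.
exists (3 * m + c')%N, (q + m + c')%N; split.
- lia.
- lia.
- apply/eqP => /(congr1 (divn^~ m)); rewrite divnMDl// divn_small// addn0 => h.
  by rewrite -h ltnn in kr.
rewrite config_dist /row_radius /row_angle divnMDl// modnMDl (divn_small cm')
  (modn_small cm') kr /=.
have -> : ((q + m + c') %/ m - 3 = 0)%N by move: kr; lia.
rewrite subn0; congr chord.
have key : (m * m + c' * m.-1 + y = (q + m + c') * m)%N.
  have h2 : (y = q * m + c')%N by exact: divn_eq.
  have h3 : (c' * m.-1 + c' = c' * m)%N
    by rewrite -[in RHS](prednK m0) mulnS addnC.
  by rewrite h2 !mulnDl -h3; lia.
have := congr1 (fun x : nat => x%:R * top_angle R m) key.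
rewrite /= natrD mulrDl; lra.
Qed.

(** * Realising a distance just below a test radius *)

Lemma chord0 (R : realType) (a b : R) : chord a b 0 = `|a - b|.
Proof. by rewrite -sqrtr_sqr /chord cos0; congr Num.sqrt; ring. Qed.

(** The chord starts from [|a - b|] at angle [0] and grows at rate at most [r]. Hence the arc of
    length [e] that ends at the target angle does not pass below [0]. *)
Lemma chord_angle_ge (R : realType) (r a b x e : R) :
  0 < a <= r -> 0 < b <= r -> 0 <= e -> x <= a + b -> `|a - b| <= x - r * e ->
  e <= chord_angle a b x.
Proof.
move=> ar br e0 xab abx; have /andP[a0 ra] := ar; have /andP[b0 _] := br.
have r0 : 0 < r by exact: lt_le_trans ra.
have re : 0 <= r * e by rewrite mulr_ge0// ltW.
have [|/andP[p0 ppi] pE] := @chord_angleP R a b x a0 b0.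
  by apply/andP; split; lra.
have := chord_lipschitz ar br (lexx _) p0 ppi.
by rewrite pE chord0 subr0 => h; rewrite -(ler_pM2l r0); lra.
Qed.

(* The slope [L] is either the trivial one, or, near the diameter [2 * r], the
   square root of the depth. *)
Lemma chord_arc (R : realType) (r L a b x e p : R) :
  0 < a <= r -> 0 < b <= r -> 0 <= e -> x <= a + b -> `|a - b| <= x - r * e ->
  L = r \/ [/\ r <= x - 1, r * e <= 1, 0 <= L
            & (2 * r) ^+ 2 - (x - 1) ^+ 2 <= L ^+ 2] ->
  chord_angle a b x - e <= p <= chord_angle a b x ->
  x - L * e <= chord a b p <= x.
Proof.
move=> ar br e0 xab abx HL /andP[p1 p2].
have ep := chord_angle_ge ar br e0 xab abx.
have /andP[a0 ra] := ar; have /andP[b0 _] := br.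
have r0 : 0 < r by exact: lt_le_trans ra.
have re : 0 <= r * e by rewrite mulr_ge0// ltW.
have [|/andP[q0 qpi] qE] := @chord_angleP R a b x a0 b0.
  by apply/andP; split; lra.
have p0 : 0 <= p by lra.
have := ler_chord (ltW a0) (ltW b0) p0 p2 qpi; rewrite qE => px.
have := chord_lipschitz ar br p0 p2 qpi; rewrite qE => h1.
have h2 : r * (chord_angle a b x - p) <= r * e
  by rewrite ler_wpM2l ?(ltW r0)//; lra.
rewrite px andbT; case: HL => [->|[rx re1 L0 HL]]; first lra.
(* The trivial slope and [r * e <= 1] keep the chord at least [x - 1], where the finer slope is at
   most [L]. *)
have rp : r <= chord a b p by lra.
have := chord_lipschitz_far ar br p0 p2 qpi rp; rewrite qE => h3.
have qL : Num.sqrt ((2 * r) ^+ 2 - chord a b p ^+ 2) <= L.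
  rewrite -(ger0_norm L0) -sqrtr_sqr ler_wsqrtr//; apply: le_trans HL.
  rewrite lerD2l lerN2 ler_pXn2r ?nnegrE//; lra.
have : Num.sqrt ((2 * r) ^+ 2 - chord a b p ^+ 2) * (chord_angle a b x - p) <=
  L * e.
  by apply: ler_pM => //; rewrite ?sqrtr_ge0//; lra.
lra.
Qed.

(** Index of the last multiple of [fine_angle] not beyond the angle at which points of the circles
    [i] and [j] are [x] apart; it serves as the [z0] of [hits]. *)
Definition base_index (R : realType) (m M : nat) (x : R) (i j : nat) : nat :=
  Num.truncn (chord_angle (16 * m - (1 + 2 * i))%:R (16 * m - (2 + 2 * j))%:R x
              / fine_angle R m M).

(* The value is the junk [0] when [w <= i]. *)
Definition extend (w M : nat) (t : {ffun 'I_w -> 'I_M}) (i : nat) : nat :=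
  if insub i is Some i' then val (t i') else 0%N.

Lemma extendE (w M : nat) (t : {ffun 'I_w -> 'I_M}) (i : 'I_w) :
  extend t i = t i.
Proof. by rewrite /extend valK. Qed.

Lemma row_radiusE (R : realType) (m k : nat) : (0 < k)%N -> (k < 16 * m)%N ->
  (0 < ((16 * m - k)%:R : R) <= (16 * m)%:R) /\
  ((16 * m - k)%:R = (16 * m)%:R - k%:R :> R).
Proof.
move=> k0 km; rewrite natrB ?(ltnW km)//; split => //;
  rewrite subr_gt0 ltr_nat km.
by rewrite gerBl ler0n.
Qed.

(** A hit gives two points whose angle is below the target angle by at most [kap] fine units, and
    the slope [L] turns this into a distance. The bound on [x + (4 * S + 2 * W)] keeps [x] at most
    the sum of the radii of every pair compared. *)
Lemma wait_cover (R : realType) (m M w S W : nat) (L x : R)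
    (t u : {ffun 'I_w -> 'I_M}) :
  let s := (arc_step M S W)%:R * (L * fine_angle R m M) in
  let V := (wait S W (base_index m M x) t u)%:R * s in
  (256 <= m)%N -> (0 < S)%N -> (0 < W)%N -> (S + W <= w)%N -> (S * W <= M)%N ->
  (w <= 4 * m)%N -> x + (4 * S + 2 * W)%:R <= (32 * m)%:R -> 1 <= x - V ->
  (W = 1%N /\ L = (16 * m)%:R) \/ (2 * W)%:R <= x ->
  L = (16 * m)%:R \/ [/\ (16 * m)%:R <= x - 1, 0 <= L
            & (2 * (16 * m)%:R) ^+ 2 - (x - 1) ^+ 2 <= L ^+ 2] ->
  exists k l, [/\ (k < (4 + 2 * w) * m)%N, (l < (4 + 2 * w) * m)%N, k != l &
    x - V <= edist (config R m M (extend t) (extend u) k)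
                   (config R m M (extend t) (extend u) l) <= x].
Proof.
move=> s V m256 S0 W0 SWw SWM wm xm xV HW HL.
have m0 : (0 < m)%N by exact: leq_trans m256.
have SW0 : (0 < S * W)%N by rewrite muln_gt0 S0.
have M0 : (0 < M)%N by exact: leq_trans SWM.
have w0 : (0 < w)%N by apply: leq_trans SWw; rewrite addn_gt0 S0.
have mR : 256 <= m%:R :> R by rewrite ler_nat.
have MR : 0 < M%:R :> R by rewrite ltr0n.
have mR0 : 0 < m%:R :> R by lra.
set g := fine_angle R m M.
have gE : g * (m%:R ^+ 2 * M%:R) = 2 * pi.
  by rewrite /g /fine_angle divfK// gt_eqF// mulr_gt0 ?exprn_gt0.
have g0 : 0 < g by rewrite divr_gt0 ?mulr_gt0 ?exprn_gt0 ?pi_gt0.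
have pi4 : pi < 4 :> R by have := pihalf_lt2 R; lra.
set r : R := (16 * m)%:R; have rE : r = 16 * m%:R by rewrite /r natrM.
have [k0 [/andP[k1 kSW] kV]] := wait_hits (base_index m M x) t u S0 W0 w0.
move/existsP=> [i /existsP[j /existsP[kk /and3P[iS /andP[ij jiW] /eqP zE]]]].
set kap := (k0 * arc_step M S W)%N in kk zE.
have kapM : (kap <= 2 * M)%N.
  by apply: leq_trans (arc_step_le SWM); rewrite leq_mul2r kSW orbT.
(* At most [2 * M] units, that is [4 pi / m ^ 2], times the radius [16 * m]: at most [1] since
   [m >= 256] and [pi < 4]. *)
have rkap : r * (kap%:R * g) <= 1.
  have h : kap%:R * g <= (2 * M%:R) * g.
    by rewrite ler_wpM2r ?(ltW g0)// -natrM ler_nat.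
  have h2 : r * (kap%:R * g) <= r * ((2 * M%:R) * g) by rewrite ler_wpM2l.
  apply: le_trans h2 _; rewrite -(ler_pM2l mR0) rE.
  have -> : m%:R * (16 * m%:R * (2 * M%:R * g)) = 32 * (g * (m%:R ^+ 2 *
    M%:R)) by ring.
  by rewrite gE; lra.
set a : R := (16 * m - (1 + 2 * i))%:R; set b : R := (16 * m - (2 + 2 * j))%:R.
have iw := ltn_ord i; have jw := ltn_ord j.
have w16 : (2 + 2 * w <= 16 * m)%N by move: (wm) (m256); clear; lia.
have [ar aE] : 0 < a <= r /\ a = r - (1 + 2 * i)%:R.
  by apply: row_radiusE => //; move: w16 iw; clear; lia.
have [br bE] : 0 < b <= r /\ b = r - (2 + 2 * j)%:R.
  by apply: row_radiusE => //; move: w16 jw; clear; lia.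
rewrite natrD natrM in aE; rewrite natrD natrM in bE.
have ijR : i%:R <= j%:R :> R by rewrite ler_nat.
have abE : `|a - b| = 1 + 2 * (j%:R - i%:R) by rewrite ger0_norm aE bE; lra.
have jiWR : j%:R - i%:R + 1 <= W%:R :> R.
  by rewrite -natrB// natr1 ler_nat ltn_subLR.
have iSR : i%:R + 1 <= S%:R :> R by rewrite natr1 ler_nat.
have xab : x <= a + b.
  by move: xm; rewrite aE bE natrD !natrM /r natrM; lra.
have V0 : k0%:R * s = kap%:R * (L * g) by rewrite /s /kap natrM mulrA.
have kapV : L * (kap%:R * g) <= V.
  rewrite mulrCA -V0 /V ler_wpM2r ?ler_nat// /s mulr_ge0// mulr_ge0 ?(ltW g0)//.
  by case: HL => [->//|[]].
have kg0 : 0 <= kap%:R * g by rewrite mulr_ge0 ?(ltW g0).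
(* The radii differ by at most [2 * W - 1], and the arc costs at most [1] by [rkap]. For [W = 1]
   with the trivial slope, the radii differ by exactly [1] and [1 <= x - V] is used instead. *)
have abx : `|a - b| <= x - r * (kap%:R * g).
  rewrite abE; case: HW => [[W1 Lr]|Wx]; last by move: Wx; rewrite natrM; lra.
  by rewrite W1 in jiWR; rewrite Lr -/r in kapV; lra.
have kz : (kk <= base_index m M x i j)%N.
  have := chord_angle_ge ar br kg0 xab abx.
  rewrite -ler_pdivlMr// => h; apply: leq_trans (ltnW (ltn_ord kk)) _.
  by rewrite /base_index truncn_ge_nat// (le_trans _ h).
pose z := (base_index m M x i j - kk)%N.
have tM : (extend t i < M)%N by rewrite extendE.
have tuz : extend t i = z + extend u j %[mod M].
  rewrite !extendE; apply/eqP; rewrite -(eqn_modDr kk) zE.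
  by rewrite /z addnAC subnK.
have [k [l [km lm kl dE]]] := config_pair R m0 M0 tM iw jw tuz.
exists k, l; split => //; rewrite dE.
have /andP[z1 z2] : chord_angle a b x - kap%:R * g <= z%:R * g <= chord_angle
  a b x.
  have ca0 : 0 <= chord_angle a b x.
    exact: le_trans (chord_angle_ge ar br kg0 xab abx).
  have /andP[t1 t2] : (base_index m M x i j)%:R <= chord_angle a b x / g
     < (base_index m M x i j).+1%:R by apply: truncn_itv;
       rewrite divr_ge0 ?(ltW g0).
  rewrite ler_pdivlMr// in t1; rewrite ltr_pdivrMr// in t2.
  have kk1 : kk%:R + 1 <= kap%:R :> R by rewrite natr1 ler_nat.
  have kk2 : (kk%:R + 1) * g <= kap%:R * g by rewrite ler_wpM2r ?(ltW g0).
  have kk3 : 0 <= kk%:R * g by rewrite mulr_ge0 ?(ltW g0).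
  rewrite /z natrB//; rewrite -natr1 in t2; apply/andP; split; lra.
have /andP[d1 d2] : x - L * (kap%:R * g) <= chord a b (z%:R * g) <= x.
  apply: chord_arc ar br kg0 xab abx _ _; last by rewrite z1.
  by case: HL => [->|[h1 h2 h3]]; [left|right].
by rewrite d2 andbT; apply: le_trans d1; rewrite lerD2l lerN2.
Qed.

Lemma top_cover (R : realType) (m M : nat) (t u : nat -> nat) (L x : R) :
  (256 <= m)%N -> (32 * m)%:R - 6 <= x <= (32 * m)%:R -> 0 <= L ->
  (2 * (16 * m)%:R) ^+ 2 - (x - 1) ^+ 2 <= L ^+ 2 ->
  exists k l, [/\ (k < 4 * m)%N, (l < 4 * m)%N, k != l &
    x - L * top_angle R m <= edist (config R m M t u k) (config R m M t u l)
      <= x].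
Proof.
move=> m256 /andP[x1 x2] L0 HL.
have m0 : (0 < m)%N by exact: leq_trans m256.
have mR : 256 <= m%:R :> R by rewrite ler_nat.
have mR0 : 0 < m%:R :> R by lra.
set h := top_angle R m.
have hE : h * (4 * m%:R ^+ 2) = pi.
  by rewrite /h /top_angle divfK// gt_eqF// mulr_gt0 ?exprn_gt0.
have h0 : 0 < h by rewrite divr_gt0 ?mulr_gt0 ?exprn_gt0 ?pi_gt0.
have pi4 : pi < 4 :> R by have := pihalf_lt2 R; lra.
have pi2 := pi_ge2 R.
set r : R := (16 * m)%:R; have rE : r = 16 * m%:R by rewrite /r natrM.
have x1' : 2 * r - 6 <= x by move: x1; rewrite rE natrM; lra.
have x2' : x <= r + r by move: x2; rewrite rE natrM; lra.
have r0 : 0 < r by rewrite rE; lra.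
have rr : 0 < r <= r by rewrite r0 lexx.
have mh : m%:R * h <= 1 / 256.
  have : 256 * (m%:R * h) <= m%:R * (m%:R * h).
    by rewrite ler_wpM2r// mulr_ge0// ltW.
  lra.
have rh : r * h <= 1 by rewrite rE; lra.
have h1 : h <= 1 / 256.
  have : 1 * h <= m%:R * h by rewrite ler_wpM2r ?(ltW h0)//; lra.
  lra.
have abx : `|r - r| <= x - r * h by rewrite subrr normr0 rE in rh *; lra.
set p0 := chord_angle r r x.
have [|/andP[q0 qpi] qE] := @chord_angleP R r r x r0 r0.
  by apply/andP; split => //; move: abx; have := mulr_ge0 (ltW r0) (ltW h0);
    lra.
rewrite -/p0 in q0 qpi qE.
pose y' := (pi - p0) / 2.
have y'0 : 0 <= y' by rewrite divr_ge0// subr_ge0.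
have sy : y' / 2 <= sin y' by apply: sin_ge_half; rewrite /y'; apply/andP;
  split; lra.
have cE : cos (p0 / 2) = sin y'.
  rewrite (_ : p0 / 2 = pi / 2 - y'); last by rewrite /y'; field.
  by rewrite cosB cos_pihalf sin_pihalf mul0r add0r mul1r.
(* From [r ^ 2 * y' ^ 2 <= (2 * r) ^ 2 - x ^ 2 <= 24 * r] and [r >= 4096]. The purpose is to keep
   the deviation from [pi] below [pi / 4], the range of [config_top]. *)
have y'small : y' <= 1 / 10.
  have := chord_far p0 (ltW r0) (ltW r0); rewrite qE cE => E.
  have s2 : (y' / 2) ^+ 2 <= sin y' ^+ 2 by rewrite ler_pXn2r ?nnegrE//; lra.
  have rs : r ^+ 2 * (y' / 2) ^+ 2 <= r ^+ 2 * sin y' ^+ 2.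
    by rewrite ler_wpM2l ?sqr_ge0.
  have xr : (2 * r - x) * (2 * r + x) <= 6 * (4 * r).
    by apply: ler_pM; rewrite rE in x1' x2' *; lra.
  have ry : r * (r * y' ^+ 2) <= r * 24 by lra.
  rewrite ler_pM2l// rE in ry.
  rewrite leNgt; apply/negP => y1.
  have : 256 * y' ^+ 2 <= m%:R * y' ^+ 2 by rewrite ler_wpM2r ?sqr_ge0.
  have : (1 / 10) ^+ 2 < y' ^+ 2 by rewrite ltr_pXn2r ?nnegrE//; lra.
  lra.
have p0E : pi - p0 = 2 * y' by rewrite /y'; field.
(* Rounding the deviation from [pi] up keeps the chord at most [x]. *)
pose y := (Num.truncn ((pi - p0) / h)).+1.
have /andP[t1 t2] : (Num.truncn ((pi - p0) / h))%:R <= (pi - p0) / h < y%:R.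
  by apply: truncn_itv; rewrite divr_ge0 ?subr_ge0 ?(ltW h0).
rewrite ltr_pdivrMr// in t2; rewrite ler_pdivlMr// in t1.
have yE : y%:R * h = (Num.truncn ((pi - p0) / h))%:R * h + h.
  by rewrite /y -natr1 mulrDl mul1r.
have ym : (y < m * m)%N.
  rewrite -(ltr_nat R) -(ltr_pM2r h0) natrM yE.
  have -> : m%:R * m%:R * h = pi / 4 by rewrite -hE; field.
  lra.
have [k [l [km lm kl dE]]] := config_top R M t u m0 ym.
exists k, l; split => //; rewrite dE -/h -/r.
apply: (chord_arc rr rr (ltW h0) x2' abx).
  right; split => //; rewrite rE in x1' *; lra.
by rewrite -/p0 yE in t2 *; apply/andP; split; lra.
Qed.

(** * Averaging over the shifts *)

(* Block [i] consists of the test points in [[i, i + 1)], at depth at least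
   [depth N i] below the diameter [32 * N ^ 4].  For
   [depth N i < 6] the outermost circle is enough. *)
Definition depth (N i : nat) : nat := (32 * N ^ 4 - 1 - i)%N.

(** Pairs used at depth [t] must satisfy [4 * S + 2 * W <= t]. With [S = W] this gives [t / 6],
    until the [2 * N ^ 3] circles of each family cap [S] and [W] at [N ^ 3]. *)
Definition far_block (N i : nat) : bool := (depth N i < 6 * N ^ 3)%N.

Definition block_S (N i : nat) : nat :=
  if far_block N i then (depth N i %/ 6)%N else (N ^ 3)%N.

(* Only pairs of circles whose radii differ by at most [x] realise the distance
   [x], which limits [W] for small [x]; powers of [N] are enough. *)
Definition block_W (N i : nat) : nat :=
  if far_block N i then (depth N i %/ 6)%N
  else if (i < 2 * N)%N then 1%N
  else if (i < 2 * N ^ 2)%N then N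
  else if (i < 2 * N ^ 3)%N then (N ^ 2)%N else (N ^ 3)%N.

(** With [D = 32 * N ^ 4], the radicand bounds [D ^ 2 - (x - 1) ^ 2 = (D - x + 1) * (D + x - 1)] on
    block [i]. *)
Definition block_L (R : realType) (N i : nat) : R :=
  if far_block N i then Num.sqrt (64 * (N ^ 4)%:R * (depth N i + 2)%:R)
  else (16 * N ^ 4)%:R.

Definition block_step (R : realType) (N i : nat) : R :=
  (arc_step (N ^ 6) (block_S N i) (block_W N i))%:R
  * (block_L R N i * fine_angle R (N ^ 4) (N ^ 6)).

(* Bounds the distance from the test point [c / Q] down to the closest distance
   of the configuration. *)
Definition lag_bound (R : realType) (N Q c : nat)
    (t u : {ffun 'I_(2 * N ^ 3) -> 'I_(N ^ 6)}) : R :=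
  let i := (c %/ Q)%N in
  if (depth N i < 6)%N then block_L R N i * top_angle R (N ^ 4)
  else (wait (block_S N i) (block_W N i)
          (base_index (N ^ 4) (N ^ 6) (c%:R / Q%:R : R)) t u)%:R
       * block_step R N i.

Definition block_cost (R : realType) (N i : nat) : R :=
  if (depth N i < 6)%N then block_L R N i * top_angle R (N ^ 4)
  else 1029 * block_step R N i.

Lemma block_params (N i : nat) : (0 < N)%N -> (6 <= depth N i)%N ->
  [/\ (0 < block_W N i <= block_S N i)%N,
      (block_S N i + block_W N i <= 2 * N ^ 3)%N &
      (block_S N i * block_W N i <= N ^ 6)%N].
Proof.
move=> N0 d6; have X1 : (0 < N ^ 3)%N by rewrite expn_gt0 N0.
suff [W0 WS SN] : [/\ (0 < block_W N i)%N, (block_W N i <= block_S N i)%N &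
   (block_S N i <= N ^ 3)%N].
  split; first by rewrite W0.
    by rewrite mul2n -addnn leq_add// (leq_trans WS).
  by rewrite (expnD N 3 3) leq_mul// (leq_trans WS).
rewrite /block_W /block_S; case: ifP => [|_].
  rewrite /far_block => h; rewrite leqnn divn_gt0// d6; split => //.
  by rewrite ltnW// ltn_divLR// mulnC.
do 3?case: ifP => _; split; rewrite ?expn_gt0 ?N0 ?leqnn//.
- by rewrite -[leqLHS]expn1 leq_pexp2l.
- by rewrite leq_pexp2l.
Qed.

Lemma block_L_ge0 (R : realType) (N i : nat) : 0 <= block_L R N i.
Proof. by rewrite /block_L; case: ifP => _; rewrite ?sqrtr_ge0. Qed.

Lemma top_angle_gt0 (R : realType) (m : nat) : (0 < m)%N -> 0 < top_angle R m.
Proof.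
by move=> m0; rewrite divr_gt0 ?pi_gt0// mulr_gt0// exprn_gt0// ltr0n.
Qed.

Lemma fine_angle_gt0 (R : realType) (m M : nat) :
  (0 < m)%N -> (0 < M)%N -> 0 < fine_angle R m M.
Proof.
move=> m0 M0; rewrite divr_gt0 ?mulr_gt0 ?pi_gt0 ?exprn_gt0 ?ltr0n//.
Qed.

Lemma block_step_ge0 (R : realType) (N i : nat) : (0 < N)%N ->
  0 <= block_step R N i.
Proof.
move=> N0; rewrite mulr_ge0// mulr_ge0 ?block_L_ge0// ltW// fine_angle_gt0//;
  by rewrite expn_gt0 N0.
Qed.

Lemma lag_bound_ge0 (R : realType) (N Q c : nat)
    (t u : {ffun 'I_(2 * N ^ 3) -> 'I_(N ^ 6)}) : (0 < N)%N ->
  0 <= lag_bound R Q c t u.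
Proof.
move=> N0; rewrite /lag_bound; case: ifP => _.
  by rewrite mulr_ge0 ?block_L_ge0// ltW// top_angle_gt0// expn_gt0 N0.
by rewrite mulr_ge0 ?block_step_ge0.
Qed.

Lemma far_block_slope (R : realType) (N i : nat) (x : R) :
  (0 < N)%N -> (i < 32 * N ^ 4)%N -> far_block N i -> 1 <= x ->
  i%:R <= x <= i.+1%:R ->
  (2 * (16 * N ^ 4)%:R) ^+ 2 - (x - 1) ^+ 2 <= block_L R N i ^+ 2.
Proof.
move=> N0 iD fi x1 /andP[ix xi]; rewrite /block_L fi sqr_sqrtr; last first.
  by rewrite !mulr_ge0.
have -> : (depth N i + 2)%:R = (32 * N ^ 4)%:R - i%:R + 1 :> R.
  have -> : (depth N i + 2 = (32 * N ^ 4 - i) + 1)%N by rewrite /depth; lia.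
  by rewrite natrD natrB// ltnW.
move: iD; rewrite -(ler_nat R); move: (N ^ 4)%N => n.
rewrite !natrM -natr1 in xi *; move: n%:R => m im.
have -> : (2 * (16 * m)) ^+ 2 - (x - 1) ^+ 2 = (32 * m - x + 1) * (32 * m + x
  - 1).
  by ring.
rewrite mulrC; apply: ler_pM; lra.
Qed.

Lemma block_cover (R : realType) (N Q c : nat)
    (t u : {ffun 'I_(2 * N ^ 3) -> 'I_(N ^ 6)}) :
  (4 <= N)%N -> (0 < Q)%N -> (Q <= c < 32 * N ^ 4 * Q)%N ->
  1 <= c%:R / Q%:R - lag_bound R Q c t u ->
  let m := (N ^ 4)%N in let w := (2 * N ^ 3)%N in
  exists k l, [/\ (k < (4 + 2 * w) * m)%N, (l < (4 + 2 * w) * m)%N, k != l &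
    c%:R / Q%:R - lag_bound R Q c t u
      <= edist (config R m (N ^ 6) (extend t) (extend u) k)
               (config R m (N ^ 6) (extend t) (extend u) l) <= c%:R / Q%:R].
Proof.
move=> N4 Q0 /andP[Qc cD] cV m w.
have N0 : (0 < N)%N by exact: leq_trans N4.
have m256 : (256 <= m)%N by rewrite /m -[256%N]/(4 ^ 4)%N leq_exp2r.
set i := (c %/ Q)%N; set x := c%:R / Q%:R in cV *.
have Q0R : 0 < Q%:R :> R by rewrite ltr0n.
have i1 : (1 <= i)%N by rewrite divn_gt0.
have iD : (i < 32 * N ^ 4)%N by rewrite ltn_divLR.
have ix : i%:R <= x <= i.+1%:R.
  rewrite ler_pdivlMr// ler_pdivrMr// -!natrM !ler_nat leq_trunc_div.
  by rewrite ltnW// ltn_ceil.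
have x1 : 1 <= x by case/andP: ix => ix _; apply: le_trans ix; rewrite ler1n.
have mN3 : (4 * N ^ 3 <= m)%N by rewrite /m expnS leq_mul2r N4 orbT.
have [d6|d6] := ltnP (depth N i) 6.
  have fi : far_block N i.
    by apply: leq_trans d6 _; rewrite leq_pmulr// expn_gt0 N0.
  have x6 : (32 * m)%:R - 6 <= x <= (32 * m)%:R.
    case/andP: ix => ix xi.
    have h1 : (32 * m <= i + 6)%N by move: d6; rewrite /depth -/m; clear; lia.
    have h2 : (i.+1 <= 32 * m)%N by [].
    rewrite -(ler_nat R) natrD in h1; rewrite -(ler_nat R) in h2; apply/andP;
      split; lra.
  have [k [l [km lm kl dE]]] := top_cover (N ^ 6) (extend t) (extend u) m256 x6
    (block_L_ge0 R N i) (far_block_slope N0 iD fi x1 ix).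
  exists k, l; split; rewrite ?(leq_trans km) ?(leq_trans lm) ?leq_mul
    ?leq_addr//.
  by rewrite /lag_bound -/i d6.
have [/andP[W0 WS] SWw SWM] := block_params N0 d6.
have wm : (w <= 4 * m)%N by move: mN3; rewrite /w; clear; lia.
have /andP[ix1 xi1] := ix.
rewrite /lag_bound -/i ltnNge d6 /= in cV *; rewrite -/x in cV *.
apply: wait_cover => //; first exact: leq_trans WS.
- have : (i.+1 + (4 * block_S N i + 2 * block_W N i) <= 32 * m)%N.
    rewrite /block_S /block_W; case: ifP => [_|].
      by have := leq_trunc_div (depth N i) 6; rewrite /depth -/m; move: d6 iD;
        rewrite /depth -/m; clear; lia.
    move=> nf; have : (block_W N i <= N ^ 3)%N by move: WS; rewrite /block_S nf.
    rewrite /block_W nf; move: nf; rewrite /far_block;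
      set W := (if _ then _ else _).
    by rewrite /depth -/m; move: iD; rewrite -/m; clear; lia.
  by rewrite -(ler_nat R) natrD; lra.
(* Outside the far blocks the thresholds of [block_W] read [2 * W <= i]; only [W = 1] needs the
   other alternative. *)
- rewrite /block_L /block_W; case: ifP => fi.
    right; apply: le_trans ix1; rewrite ler_nat.
    have := leq_trunc_div (depth N i) 6; move: fi mN3 iD;
      rewrite /far_block /depth -/m; clear; lia.
  case: ifP => [_|/negbT]; first by left.
  rewrite -leqNgt => h1; right; apply: le_trans ix1; rewrite ler_nat.
  case: ifP => [//|/negbT]; rewrite -leqNgt => h2.
  by case: ifP => [//|/negbT]; rewrite -leqNgt => h3.
- have [fi|fi] := boolP (far_block N i); last by left;
  rewrite /block_L (negbTE fi).
  right; split; [|exact: block_L_ge0|exact: (far_block_slope N0 iD fi)].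
  have : (16 * m + 1 <= i)%N.
    by move: fi mN3 iD m256; rewrite /far_block /depth -/m; clear; lia.
  by rewrite -(ler_nat R) natrD; lra.
Qed.

Lemma sum_lag_bound (R : realType) (N Q c : nat) : (0 < N)%N ->
  \sum_(t : {ffun 'I_(2 * N ^ 3) -> 'I_(N ^ 6)})
  \sum_(u : {ffun 'I_(2 * N ^ 3) -> 'I_(N ^ 6)}) lag_bound R Q c t u
  <= \sum_(t : {ffun 'I_(2 * N ^ 3) -> 'I_(N ^ 6)})
     \sum_(u : {ffun 'I_(2 * N ^ 3) -> 'I_(N ^ 6)}) block_cost R N (c %/ Q).
Proof.
move=> N0; rewrite /lag_bound /block_cost; case: ltnP => // d6.
have [W0 SWw SWM] := block_params N0 d6.
under eq_bigr do rewrite -mulr_suml.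
rewrite -mulr_suml; apply: le_trans (ler_wpM2r (block_step_ge0 R
  _ N0) (sum_wait R _ W0 SWw SWM)) _.
rewrite !sumr_const !card_ffun !card_ord -mulrnA -expnD -[leRHS]mulr_natr natrX.
by rewrite !natrX mulrAC.
Qed.

(** First-moment argument: only the sum of the lags over all test points is bounded, so one choice
    of shifts serves them all together. *)
Lemma good_shifts (R : realType) (N Q B : nat) : (0 < N)%N ->
  exists t u : {ffun 'I_(2 * N ^ 3) -> 'I_(N ^ 6)},
    \sum_(Q <= c < B) lag_bound R Q c t u
    <= \sum_(Q <= c < B) block_cost R N (c %/ Q).
Proof.
move=> N0; pose G : R := \sum_(Q <= c < B) block_cost R N (c %/ Q).
have M0 : (0 < N ^ 6)%N by rewrite expn_gt0 N0.
have [[t u] /= tu|no] := pickP (fun tu : {ffun 'I_(2 * N ^ 3) -> 'I_(N ^ 6)} *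
    {ffun 'I_(2 * N ^ 3) -> 'I_(N ^ 6)} =>
    \sum_(Q <= c < B) lag_bound R Q c tu.1 tu.2 <= G).
  by exists t, u.
have : \sum_(tu : {ffun 'I_(2 * N ^ 3) -> 'I_(N ^ 6)} * {ffun 'I_(2 * N ^ 3)
  -> 'I_(N ^ 6)}) G
   < \sum_(tu : {ffun 'I_(2 * N ^ 3) -> 'I_(N ^ 6)} * {ffun 'I_(2 * N ^ 3) ->
     'I_(N ^ 6)}) \sum_(Q <= c < B) lag_bound R Q c tu.1 tu.2.
  pose z := [ffun _ : 'I_(2 * N ^ 3) => Ordinal M0].
  apply: ltr_sum; first by apply/hasP; exists (z, z); rewrite ?mem_index_enum.
  by move=> tu _; rewrite ltNge no.
rewrite ltNge => /negP[].
rewrite exchange_big /= /G [leRHS]exchange_big /=; apply: ler_sum => c _.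
rewrite -(pair_bigA _ (fun t u => lag_bound R Q c t u)).
rewrite -(pair_bigA _ (fun _ _ => block_cost R N (c %/ Q))).
exact: sum_lag_bound.
Qed.

(** * Summing the costs of the blocks *)

Lemma sum_blocks (R : realType) (f : nat -> R) (Q B : nat) : (0 < Q)%N ->
  \sum_(Q <= c < B * Q) f (c %/ Q)%N = Q%:R * \sum_(1 <= i < B) f i.
Proof.
move=> Q0; elim: B => [|[|B] IH]; first by rewrite !big_geq// mulr0.
  by rewrite mul1n !big_geq// mulr0.
rewrite big_nat_recr//= mulrDr -IH (big_cat_nat (n := (B.+1 * Q)%N))//=;
  last 2 first.
- by rewrite leq_pmull.
- by rewrite leq_mul2r leqnSn orbT.
congr (_ + _); rewrite (eq_big_nat _ _ (F2 := fun=> f B.+1)).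
  by rewrite sumr_const_nat -mulnBl subSnn mul1n mulr_natl.
move=> c /andP[c1 c2]; congr f; apply/eqP.
by rewrite eqn_leq -ltnS ltn_divLR// c2 leq_divRL.
Qed.

(** Telescoping: for [b ^ 2 = a ^ 2 + 1] one has [2 / a - 2 / b = 2 / (a * b * (a + b)) >= 1 / b ^
    3]. *)
Lemma sum_sqrt_div_sqr (R : realType) (n : nat) :
  \sum_(1 <= i < n.+1) Num.sqrt i.+1%:R / i.+1%:R ^+ 2
  <= 2 - 2 / Num.sqrt n.+1%:R :> R.
Proof.
elim: n => [|n IH]; first by rewrite big_geq// sqrtr1; lra.
rewrite big_nat_recr//; apply: le_trans (lerD IH (lexx _)) _.
have a0 : 0 < Num.sqrt n.+1%:R :> R by rewrite sqrtr_gt0 ltr0n.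
have b0 : 0 < Num.sqrt n.+2%:R :> R by rewrite sqrtr_gt0 ltr0n.
have aE : Num.sqrt n.+1%:R ^+ 2 = n.+1%:R :> R by rewrite sqr_sqrtr.
have bE : Num.sqrt n.+2%:R ^+ 2 = n.+2%:R :> R by rewrite sqr_sqrtr.
rewrite -[X in _ / X ^+ 2]bE.
have ab : Num.sqrt n.+2%:R ^+ 2 = Num.sqrt n.+1%:R ^+ 2 + 1 :> R.
  by rewrite aE bE natr1.
move: (Num.sqrt n.+1%:R) (Num.sqrt n.+2%:R) a0 b0 ab => a b a0 b0 ab.
have ltab : a <= b by rewrite -(ler_pXn2r (n := 2))// ?nnegrE ?ltW//; lra.
have -> : b / (b ^+ 2) ^+ 2 = 1 / b ^+ 3 by field; rewrite gt_eqF.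
have -> : 2 - 2 / b = 2 - 2 / a + 2 * (b - a) / (a * b).
  by field; rewrite !gt_eqF.
rewrite lerD2l ler_pdivrMr ?exprn_gt0// mulrAC ler_pdivlMr ?mulr_gt0// mul1r.
have h1 : (b - a) * (b + a) = 1 by rewrite -[RHS](addKr (a ^+ 2)) addrC -ab;
  ring.
have h2 : a * b * ((b - a) * (b + a)) <= 2 * (b - a) * b ^+ 3;
  last by rewrite h1 mulr1 in h2.
have : a * b * (b + a) <= 2 * b ^+ 3.
  have : a * (b * (b + a)) <= b * (b * (2 * b)).
    by apply: ler_pM => //; [exact: ltW|rewrite mulr_ge0//;
      lra|rewrite ler_pM2l//; lra].
  lra.
move/(ler_wpM2l (_ : 0 <= b - a)) => h3;
  apply: le_trans (_ : _ <= (b - a) * (2 * b ^+ 3)) _.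
  by apply: le_trans (h3 _); [rewrite le_eqVlt; apply/orP; left; apply/eqP;
    ring|lra].
lra.
Qed.

(** [S * W] arc steps make at most [2 * M] fine units, so [M] cancels against [fine_angle] and the
    factor [4 pi < 16] remains. *)
Lemma block_step_le (R : realType) (N i : nat) : (0 < N)%N ->
  (6 <= depth N i)%N ->
  block_step R N i * ((block_S N i)%:R * (block_W N i)%:R) * (N%:R ^+ 4) ^+ 2
  <= 16 * block_L R N i.
Proof.
move=> N0 d6; have [/andP[W0 WS] _ SWM] := block_params N0 d6.
have n0 : 0 < N%:R :> R by rewrite ltr0n.
have L0 := block_L_ge0 R N i.
have := arc_step_le SWM; rewrite -(ler_nat R) !natrM.
rewrite /block_step /fine_angle natrX !natrX; set a := (arc_step _ _ _)%:R.
move: (block_L R N i) L0 => L L0; set s := _%:R * _%:R => h.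
have n6 : 0 < N%:R ^+ 6 :> R by rewrite exprn_gt0.
have n8 : 0 < (N%:R ^+ 4) ^+ 2 :> R by rewrite !exprn_gt0.
have pi4 : pi < 4 :> R by have := pihalf_lt2 R; lra.
have pi0 := pi_ge0 R.
rewrite (_ : _ * _ * _ = (s * a) * (L * (2 * pi)) / N%:R ^+ 6); last first.
  by field; rewrite !gt_eqF.
rewrite ler_pdivrMr//.
have : (s * a) * (L * (2 * pi)) <= (2 * N%:R ^+ 6) * (L * (2 * pi)).
  by rewrite ler_wpM2r// !mulr_ge0.
have : N%:R ^+ 6 * L * pi <= N%:R ^+ 6 * L * 4.
  by rewrite ler_wpM2l ?mulr_ge0 ?(ltW n6)// ltW.
lra.
Qed.

(** A majorant of [1 / block_W] outside the far blocks, written with indicators so that it can be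
    summed one threshold at a time. *)
Definition near_weight (R : realType) (N i : nat) : R :=
  (i < 2 * N)%:R + (i < 2 * N ^ 2)%:R / N%:R + (i < 2 * N ^ 3)%:R / N%:R ^+ 2
  + 1 / N%:R ^+ 3.

Lemma near_weight_ge (R : realType) (N i : nat) : (0 < N)%N ->
  ~~ far_block N i -> 1 <= near_weight R N i * (block_W N i)%:R.
Proof.
move=> N0 nf; have n0 : 0 < N%:R :> R by rewrite ltr0n.
rewrite /near_weight /block_W (negbTE nf).
have i0 : 0 <= N%:R^-1 :> R by rewrite invr_ge0 ltW.
have i2 : 0 <= (N%:R ^+ 2)^-1 :> R by rewrite invr_ge0 exprn_ge0 ?ltW.
have i3 : 0 <= (N%:R ^+ 3)^-1 :> R by rewrite invr_ge0 exprn_ge0 ?ltW.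
have P b : 0 <= (nat_of_bool b)%:R / N%:R :> R by rewrite mulr_ge0.
have P2 b : 0 <= (nat_of_bool b)%:R / N%:R ^+ 2 :> R by rewrite mulr_ge0.
case: ifP => _; rewrite ?mulr1 /=.
  by have := P (i < 2 * N ^ 2)%N; have := P2 (i < 2 * N ^ 3)%N; lra.
case: ifP => _ /=.
  rewrite -[X in X <= _](mulVf (lt0r_neq0 n0)) ler_wpM2r ?(ltW n0)//.
  by have := P2 (i < 2 * N ^ 3)%N; lra.
case: ifP => _ /=; rewrite natrX.
  rewrite -[X in X <= _](mulVf (lt0r_neq0 (exprn_gt0 2 n0))) ler_wpM2r
    ?exprn_ge0//.
  by lra.
rewrite -[X in X <= _](mulVf (lt0r_neq0 (exprn_gt0 3 n0))) ler_wpM2r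
  ?exprn_ge0//.
by lra.
Qed.

(** Each of the three thresholds contributes at most [2 * N], and the constant term at most [32 * N]
    over fewer than [32 * N ^ 4] blocks. *)
Lemma sum_near_weight (R : realType) (N : nat) : (0 < N)%N ->
  \sum_(1 <= i < 32 * N ^ 4) near_weight R N i <= 38 * N%:R.
Proof.
move=> N0; have n0 : 0 < N%:R :> R by rewrite ltr0n.
have C (X B : nat) : \sum_(1 <= i < B) (i < X)%:R <= X%:R :> R.
  apply: le_trans (_ : (\sum_(0 <= i < B) (i < X))%N%:R <= X%:R).
    rewrite natr_sum; case: B => [|B]; first by rewrite !big_geq.
    by rewrite [leRHS]big_ltn// lerDr.
  rewrite ler_nat; elim: B => [|B IH]; first by rewrite big_geq.
  rewrite big_nat_recr//=; case: ltnP => [BX|_]; last by rewrite addn0.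
  apply: leq_trans (_ : B + 1 <= X)%N; last by rewrite addn1.
  rewrite leq_add2r -[leqRHS](muln1) -[B in (_ <= B * _)%N](subn0 B)
    -sum_nat_const_nat.
  by apply: leq_sum => k _; case: (_ < _)%N.
rewrite /near_weight !big_split /= -!mulr_suml.
have c1 := C (2 * N)%N (32 * N ^ 4)%N.
have c2 := C (2 * N ^ 2)%N (32 * N ^ 4)%N.
have c3 := C (2 * N ^ 3)%N (32 * N ^ 4)%N.
have d1 : \sum_(1 <= i < 32 * N ^ 4) (i < 2 * N)%:R <= 2 * N%:R :> R.
  by rewrite -natrM.
have d2 : (\sum_(1 <= i < 32 * N ^ 4) (i < 2 * N ^ 2)%:R) / N%:R <= 2 * N%:R
  :> R.
  rewrite ler_pdivrMr// -mulrA -expr2 -natrX -natrM; exact: c2.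
have d3 : (\sum_(1 <= i < 32 * N ^ 4) (i < 2 * N ^ 3)%:R) / N%:R ^+ 2 <= 2 *
  N%:R :> R.
  rewrite ler_pdivrMr ?exprn_gt0// -mulrA -exprS -natrX -natrM; exact: c3.
have d4 : (\sum_(1 <= i < 32 * N ^ 4) 1) / N%:R ^+ 3 <= 32 * N%:R :> R.
  rewrite ler_pdivrMr ?exprn_gt0// -mulrA -exprS -natrX -natrM.
  by rewrite sumr_const_nat ler_nat leq_subr.
lra.
Qed.

(** Both terms are nonnegative and each block needs only one. The first serves the far blocks, where
    [S * W] is of the order of the squared depth or the outermost circle is used; the second serves
    the others, where [S = N ^ 3] and [L = 16 * N ^ 4]. *)
Lemma block_cost_le (R : realType) (N i : nat) : (0 < N)%N ->
  block_cost R N i * N%:R ^+ 6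
  <= 1029 * (256 * 128) * (Num.sqrt (depth N i + 2)%:R / (depth N i + 2)%:R ^+
    2)
     + 1029 * 256 / N%:R * near_weight R N i.
Proof.
move=> N0; have n0 : 0 < N%:R :> R by rewrite ltr0n.
set f := (depth N i + 2)%:R.
have f2 : 2 <= f by rewrite ler_nat leq_addl.
have f0 : 0 < f by lra.
have sf : 0 <= Num.sqrt f by exact: sqrtr_ge0.
have t1 : 0 <= 1029 * (256 * 128) * (Num.sqrt f / f ^+ 2).
  by apply: mulr_ge0; [lra | apply: divr_ge0 (sqr_ge0 _)].
have t2 : 0 <= 1029 * 256 / N%:R * near_weight R N i.
  apply: mulr_ge0; first by apply: divr_ge0 => //; lra.
  by rewrite /near_weight !addr_ge0// divr_ge0// exprn_ge0// ltW.
have LE : far_block N i -> block_L R N i = 8 * N%:R ^+ 2 * Num.sqrt f.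
  move=> fi; rewrite /block_L fi -/f natrX sqrtrM;
    last by rewrite mulr_ge0// exprn_ge0.
  rewrite (_ : 64 * _ = (8 * N%:R ^+ 2) ^+ 2); last by ring.
  by rewrite sqrtr_sqr ger0_norm// mulr_ge0// sqr_ge0.
have [d6|d6] := ltnP (depth N i) 6.
  have fi : far_block N i.
    by apply: leq_trans d6 _; rewrite leq_pmulr// expn_gt0 N0.
  apply: le_trans (_ : _ <= 1029 * (256 * 128) * (Num.sqrt f / f ^+ 2)) _;
    last by rewrite lerDl.
  rewrite /block_cost d6 LE// /top_angle natrX.
  have -> : 8 * N%:R ^+ 2 * Num.sqrt f * (pi / (4 * (N%:R ^+ 4) ^+ 2)) * N%:R
    ^+ 6
     = 2 * pi * Num.sqrt f by field; rewrite gt_eqF.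
  rewrite [leRHS]mulrA [leRHS]mulrAC ler_wpM2r//.
  have pi4 : pi < 4 :> R by have := pihalf_lt2 R; lra.
  have f7 : f <= 7.
    by rewrite ler_nat; move: d6; clear; lia.
  have f49 : f ^+ 2 <= 49 by nra.
  rewrite ler_pdivlMr ?exprn_gt0//.
  have := pi_ge0 R; nra.
have hb := block_step_le R N0 d6.
rewrite /block_cost ltnNge d6 /=.
have s0 := block_step_ge0 R i N0.
have [fi|nf] := boolP (far_block N i).
  apply: le_trans (_ : _ <= 1029 * (256 * 128) * (Num.sqrt f / f ^+ 2)) _;
    last by rewrite lerDl.
  rewrite LE// in hb; move: hb; rewrite /block_S /block_W fi.
  set s : R := (depth N i %/ 6)%:R; move: (block_step R N i) s0 => b b0 hb.
  have fs : f <= 16 * s.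
    by rewrite -natrM ler_nat; move: d6; clear; lia.
  have fs2 : f ^+ 2 <= 256 * s ^+ 2.
    have -> : 256 * s ^+ 2 = (16 * s) ^+ 2 by ring.
    by rewrite ler_pXn2r// ?nnegrE; lra.
  rewrite [leRHS]mulrA ler_pdivlMr ?exprn_gt0//.
  have h1 : b * N%:R ^+ 6 * s ^+ 2 <= 128 * Num.sqrt f.
    rewrite -(ler_pM2l (exprn_gt0 2 n0)); lra.
  have : b * N%:R ^+ 6 * f ^+ 2 <= b * N%:R ^+ 6 * (256 * s ^+ 2).
    by rewrite ler_wpM2l// mulr_ge0// exprn_ge0.
  lra.
apply: le_trans (_ : _ <= 1029 * 256 / N%:R * near_weight R N i) _;
  last by rewrite lerDr.
have W1 := near_weight_ge R N0 nf.
move: hb; rewrite /block_L (negbTE nf) /block_S (negbTE nf) (natrM _ 16) !natrX.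
move: (block_step R N i) s0 (near_weight R N i) W1 => b b0 q.
set W : R := (block_W N i)%:R => W1 hb.
have W0 : 0 < W by rewrite ltr0n; case: (block_params N0 d6) => /andP[].
have h1 : b * W * N%:R ^+ 7 <= 256.
  rewrite -(ler_pM2l (exprn_gt0 4 n0)); lra.
rewrite [leRHS]mulrAC ler_pdivlMr// -(ler_pM2r W0).
have q1 : 256 <= 256 * (q * W) by lra.
lra.
Qed.

Lemma sum_block_cost (R : realType) (N : nat) : (0 < N)%N ->
  \sum_(1 <= i < 32 * N ^ 4) block_cost R N i
  <= (1029 * (256 * 128) * 2 + 1029 * 256 * 38) / N%:R ^+ 6.
Proof.
move=> N0; have n0 : 0 < N%:R :> R by rewrite ltr0n.
rewrite ler_pdivlMr ?exprn_gt0// mulr_suml.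
apply: le_trans (ler_sum_nat (fun i _ => block_cost_le R i N0)) _.
rewrite big_split /= -!mulr_sumr; apply: lerD.
  (* Reversing the order of summation turns the block index into the depth. *)
  apply: ler_wpM2l; [lra | rewrite big_nat_rev /=].
  rewrite (eq_big_nat _ _ (F2 := fun i => Num.sqrt i.+1%:R / i.+1%:R ^+ 2));
    last first.
    move=> i /andP[i1 iD];
      have -> // : (depth N (1 + 32 * N ^ 4 - i.+1) + 2 = i.+1)%N.
    by rewrite /depth; move: i1 iD; clear; lia.
  have D0 : (0 < 32 * N ^ 4)%N by rewrite muln_gt0 expn_gt0 N0.
  rewrite -(prednK D0); apply: le_trans (sum_sqrt_div_sqr R _) _.
  by rewrite gerBl divr_ge0// sqrtr_ge0.
apply: le_trans (ler_wpM2l _ (sum_near_weight R N0)) _.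
  by apply: divr_ge0 => //; lra.
rewrite le_eqVlt; apply/orP; left; apply/eqP; field; exact: lt0r_neq0.
Qed.

(** * Conclusion *)

Lemma edist_sym (R : realType) (x y : 'rV[R]_2) : edist x y = edist y x.
Proof.
by congr Num.sqrt; apply: eq_bigr => k _; rewrite -sqrrN opprB.
Qed.

Lemma edistxx (R : realType) (x : 'rV[R]_2) : edist x x = 0.
Proof.
by rewrite /edist big1 ?sqrtr0// => k _; rewrite subrr expr0n.
Qed.

Lemma mem_distances (R : realType) (n : nat) (p : 'I_n -> 'rV[R]_2)
    (i j : 'I_n) : i != j -> edist (p i) (p j) \in distances p.
Proof.
move=> ij; rewrite mem_sort.
wlog ltij : i j ij / (i < j)%N => [hw|].
  have [|ji|/val_inj e] := ltngtP i j; [exact: hw| |by rewrite e eqxx in ij].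
  by rewrite edist_sym; apply: hw => //; rewrite eq_sym.
by apply/imageP; exists (i, j).
Qed.

Lemma gap_sum_config (R : realType) (n : nat) (p : 'I_n -> 'rV[R]_2) (B Q : nat)
    (V : nat -> R) :
  (2 <= n)%N -> (0 < Q)%N ->
  (forall i j, i != j -> 1 <= edist (p i) (p j) <= B%:R) ->
  (forall c, 0 <= V c) ->
  (forall c, (Q <= c < B * Q)%N -> 1 <= c%:R / Q%:R - V c ->
     exists i j, i != j /\ c%:R / Q%:R - V c <= edist (p i) (p j) <= c%:R /
       Q%:R) ->
  [/\ injective p, 1 <= dist_nth p 1 &
    \sum_(1 <= i < 'C(n, 2)) (dist_nth p i.+1 - dist_nth p i) ^+ 2
    <= 4 / Q%:R * (\sum_(Q <= c < B * Q) (V c + Q%:R^-1)) + B%:R / Q%:R].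
Proof.
move=> n2 Q0 pB V0 pV.
have sB : {in distances p, forall d, 1 <= d <= B%:R}.
  move=> d; rewrite mem_sort => /imageP[[i j] /= ij ->]; apply: pB.
  by apply/eqP => e; move: ij; rewrite inE /= e ltnn.
split.
- move=> i j e; apply/eqP/negPn/negP => /pB; rewrite e edistxx.
  by case/andP; rewrite ler10.
- have /sB/andP[] // : dist_nth p 1 \in distances p.
  by rewrite mem_nth// size_distances bin_gt0.
rewrite big_add1 /= -(size_distances p).
apply: sum_gap_grid => //; first exact: sorted_distances.
move=> c cQ [d dp dc]; have [cV|cV] := lerP 1 (c%:R / Q%:R - V c).
  have [i [j [ij h]]] := pV c cQ cV.
  by exists (edist (p i) (p j)) => //; exact: mem_distances.
(* Here [c / Q - V c < 1], so any distance below the test point will do. *)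
by exists d => //; rewrite dc andbT; have /andP[d1 _] := sB d dp; lra.
Qed.

(** Finitely many [n] only affect the constant, so equally spaced points on a line suffice. *)
Lemma small_config (R : realType) (n : nat) : (2 <= n)%N ->
  exists p : 'I_n -> 'rV[R]_2,
    [/\ injective p, 1 <= dist_nth p 1 &
      \sum_(1 <= i < 'C(n, 2)) (dist_nth p i.+1 - dist_nth p i) ^+ 2
      <= 9 * n%:R ^+ 2].
Proof.
move=> n2; pose p (i : 'I_n) : 'rV[R]_2 := \row_(k < 2) (if k == 0 then i%:R
  else 0).
have dE i j : edist (p i) (p j) = `|i%:R - j%:R|.
  rewrite /edist !big_ord_recl big_ord0 !mxE /= subrr expr0n /= !addr0.
  exact: sqrtr_sqr.
have pB i j : i != j -> 1 <= edist (p i) (p j) <= n%:R.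
  rewrite dE => ij; have := ltn_ord i; have := ltn_ord j; move: ij.
  wlog ltij : i j / (i < j)%N => [hw ij jn il|_ jn _].
    have [lij|ji|/val_inj e] := ltngtP i j;
      [exact: hw| |by rewrite e eqxx in ij].
    by rewrite distrC; apply: hw => //; rewrite eq_sym.
  rewrite distrC ger0_norm ?subr_ge0 ?ler_nat ?(ltnW ltij)//.
  rewrite -natrB ?(ltnW ltij)// ler1n subn_gt0 ltij ler_nat.
  exact: leq_trans (leq_subr _ _) (ltnW jn).
have n2R : 2 <= n%:R :> R by rewrite ler_nat.
exists p.
have [|c cQ|h1 h2 h3] := @gap_sum_config R n p n 1 (fun=> n%:R) n2 isT pB.
- by [].
- rewrite divr1 => h; case/andP: cQ => _; rewrite muln1 => /ltnW.
  by rewrite -(ler_nat R) => cn; exfalso; lra.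
split=> //; apply: le_trans h3 _.
rewrite muln1 invr1 !mulr1 sumr_const_nat -[X in _ * X + _]mulr_natr natrB;
  last exact: ltnW.
nra.
Qed.

(** The first [(4 + 4 * N ^ 3) * N ^ 4] points carry the argument. The others fill further,
    unshifted circles and only have to respect the minimum distance: extra distances below a test
    point do no harm. *)
Lemma large_config (R : realType) (N n : nat) : (128 <= N)%N ->
  (8 * N ^ 7 <= n < 8 * N.+1 ^ 7)%N ->
  exists p : 'I_n -> 'rV[R]_2,
    [/\ injective p, 1 <= dist_nth p 1 &
      \sum_(1 <= i < 'C(n, 2)) (dist_nth p i.+1 - dist_nth p i) ^+ 2
      <= (4 * (1029 * (256 * 128) * 2 + 1029 * 256 * 38) + 5) / N%:R ^+ 6].
Proof.
move=> N128 /andP[Nn nN].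
have N0 : (0 < N)%N by exact: leq_trans N128.
have N4 : (4 <= N)%N by exact: leq_trans N128.
have n0 : 0 < N%:R :> R by rewrite ltr0n.
(* This [Q] makes [D / Q = N ^ (-6)], so the discretisation errors have the order of the main term;
   they account for the [5] in the constant. *)
pose D := (32 * N ^ 4)%N; pose Q := (D * N ^ 6)%N; pose m := (N ^ 4)%N.
have m0 : (0 < m)%N by rewrite expn_gt0 N0.
have D0 : (0 < D)%N by rewrite muln_gt0.
have Q0 : (0 < Q)%N by rewrite muln_gt0 D0 expn_gt0 N0.
have [t [u tu]] := good_shifts R Q (D * Q) N0.
pose p (i : 'I_n) := config R m (N ^ 6) (extend t) (extend u) i.
have base : ((4 + 2 * (2 * N ^ 3)) * m <= n)%N.
  apply: leq_trans Nn; have -> : (8 * N ^ 7 = 8 * N ^ 3 * m)%N.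
    by rewrite -mulnA -expnD.
  rewrite leq_mul2r; have : (0 < N ^ 3)%N by rewrite expn_gt0 N0.
  by move: (N ^ 3)%N => X X0; apply/orP; right; move: X0; clear; lia.
(* [n < 8 * (2 * N) ^ 7 <= 8 * N ^ 8], where [2 ^ 7 = 128 <= N]. *)
have rows (k : 'I_n) : (k %/ m <= 8 * m)%N.
  rewrite -ltnS ltn_divLR//; apply: leq_trans (ltn_ord k) _.
  apply: leq_trans (ltnW nN) _; apply: leq_trans (_ : 8 * m * m <= _)%N.
    rewrite -mulnA leq_mul2l /= /m -expnD (expnS N 7).
    apply: leq_trans (_ : (2 * N) ^ 7 <= _)%N; first by rewrite leq_exp2r//;
      move: N0; clear; lia.
    by rewrite expnMn leq_mul2r -[(2 ^ 7)%N]/128%N N128 orbT.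
  by rewrite leq_mul2r leqnSn orbT.
exists p.
have pB (i j : 'I_n) : i != j -> 1 <= edist (p i) (p j) <= D%:R.
  move=> ij; rewrite config_dist_le andbT.
  wlog ltji : i j ij / (j < i)%N => [hw|].
    have [lij|ji|/val_inj e] := ltngtP i j;
      [|exact: hw|by rewrite e eqxx in ij].
    by rewrite edist_sym; apply: hw => //; rewrite eq_sym.
  apply: config_sep => //; last by rewrite expn_gt0 N0.
  apply: leq_trans (_ : N <= m)%N; first exact: leq_trans N4.
  by rewrite -[leqLHS]expn1 leq_pexp2l.
have n2 : (2 <= n)%N.
  by apply: leq_trans Nn;
    rewrite (leq_trans (_ : _ <= 8 * 1)%N)// leq_mul2l expn_gt0 N0.
have [||h1 h2 h3] := @gap_sum_config R n p D Q (fun c => lag_bound R Q c t u)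
  n2 Q0 pB.
- by move=> c; exact: lag_bound_ge0.
- move=> c cQ cV; have [k [l [km lm kl h]]] := block_cover N4 Q0 cQ cV.
  exists (Ordinal (leq_trans km base)), (Ordinal (leq_trans lm base));
    split => //.
split=> //; apply: le_trans h3 _.
have QR : 0 < Q%:R :> R by rewrite ltr0n.
have QE : Q%:R = D%:R * N%:R ^+ 6 :> R by rewrite natrM natrX.
have DR : 0 < D%:R :> R by rewrite ltr0n.
have n6 : 0 < N%:R ^+ 6 :> R by rewrite exprn_gt0.
have DQ : D%:R / Q%:R = 1 / N%:R ^+ 6 :> R.
  by rewrite QE; field; rewrite !gt_eqF.
rewrite big_split /= mulrDr.
have s1 : 4 / Q%:R * \sum_(Q <= c < D * Q) lag_bound R Q c t u
    <= 4 * ((1029 * (256 * 128) * 2 + 1029 * 256 * 38) / N%:R ^+ 6).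
  rewrite sum_blocks// in tu.
  have := le_trans tu (ler_wpM2l (ler0n _ _) (sum_block_cost R N0)) => h.
  rewrite mulrAC ler_pdivrMr//; lra.
have s2 : 4 / Q%:R * \sum_(Q <= c < D * Q) Q%:R^-1 <= 4 / N%:R ^+ 6 :> R.
  rewrite sumr_const_nat -[X in _ / _ * X <= _]mulr_natr.
  have hD : (D * Q - Q)%:R <= D%:R * Q%:R :> R
    by rewrite -natrM ler_nat leq_subr.
  apply: le_trans (_ : 4 / Q%:R * (Q%:R^-1 * (D%:R * Q%:R)) <= _).
    by rewrite ler_wpM2l ?divr_ge0// ler_wpM2l ?invr_ge0.
  rewrite (_ : _ * _ = 4 * (D%:R / Q%:R)); last by field; rewrite gt_eqF.
  by rewrite DQ mul1r.
rewrite DQ; lra.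
Qed.

Lemma powR_scale (R : realType) (N n : nat) : (0 < N)%N ->
  (n <= 1024 * N ^ 7)%N -> (0 < n)%N ->
  (N%:R ^+ 6)^-1 <= 1024 * n%:R `^ (- (6 / 7)) :> R.
Proof.
move=> N0 nN n0; have NR : 0 < N%:R :> R by rewrite ltr0n.
have nR : 0 < n%:R :> R by rewrite ltr0n.
rewrite powRN -[leRHS]mulrC -ler_pdivrMl ?invr_gt0 ?powR_gt0// invrK.
rewrite ler_pdivrMr ?exprn_gt0//.
apply: le_trans (_ : (1024 * N%:R ^+ 7) `^ (6 / 7) <= _).
  apply: ge0_ler_powR; [lra|by rewrite nnegrE| |].
    by rewrite nnegrE mulr_ge0// exprn_ge0.
  by rewrite -natrX -natrM ler_nat.
rewrite powRM ?exprn_ge0// -(powR_mulrn 7 (ltW NR)) -powRrM.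
rewrite (_ : 7%:R * (6 / 7) = 6%:R); last by field.
rewrite powR_mulrn ?(ltW NR)// ler_wpM2r ?exprn_ge0//.
apply: ler1_powR; lra.
Qed.

Theorem theorem1 (R : realType) :
  exists c : R, 0 < c /\
    forall n : nat, (2 <= n)%N ->
      exists p : 'I_n -> 'rV[R]_2,
        [/\ injective p,
            1 <= dist_nth p 1 &
            \sum_(1 <= i < 'C(n, 2)) (dist_nth p i.+1 - dist_nth p i) ^+ 2
              <= c * n%:R `^ (- (6 / 7))].
Proof.
pose A : R := 4 * (1029 * (256 * 128) * 2 + 1029 * 256 * 38) + 5.
have [b bE] : exists b, b = (8 * 128 ^ 7)%N by exists (8 * 128 ^ 7)%N.
have A0 : 0 < A by rewrite /A; lra.
have b0 : 0 <= b%:R ^+ 3 :> R by rewrite exprn_ge0.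
(* The first term comes from [large_config] and [powR_scale]. The second covers [n < b], where
   [9 * n ^ 2 <= 9 * b ^ 2] and [1 <= b * n ^ (-6/7)]. *)
exists (1024 * A + 9 * b%:R ^+ 3); split; first lra.
move=> n n2; have n1 : 1 <= n%:R :> R by rewrite ler1n ltnW.
have P0 : 0 < n%:R `^ (- (6 / 7)) :> R by rewrite powR_gt0//; lra.
have [nb|bn] := ltnP n b.
  have [p [h1 h2 h3]] := small_config R n2.
  exists p; split => //; apply: le_trans h3 _.
  have P1 : 1 <= b%:R * n%:R `^ (- (6 / 7)) :> R.
    rewrite powRN ler_pdivlMr ?powR_gt0//; last lra.
    rewrite mul1r; apply: le_trans (ler1_powR n1 _) _; first lra.
    by rewrite ler_nat ltnW.
  have nb2 : n%:R ^+ 2 <= b%:R ^+ 2 :> R.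
    by rewrite ler_pXn2r ?nnegrE// ler_nat ltnW.
  have : b%:R ^+ 2 * 1 <= b%:R ^+ 2 * (b%:R * n%:R `^ (- (6 / 7))) :> R.
    by rewrite ler_wpM2l// exprn_ge0.
  have : 0 <= A * n%:R `^ (- (6 / 7)) by exact: mulr_ge0 (ltW A0) (ltW P0).
  lra.
have ex : exists N, (8 * N ^ 7 <= n)%N by exists 0%N.
have ub N : (8 * N ^ 7 <= n)%N -> (N <= n)%N.
  case: N => // N h; apply: leq_trans h; apply: leq_trans (_ : N.+1 ^ 7 <= _)%N.
    by rewrite -[leqLHS]expn1 leq_pexp2l.
  exact: leq_pmull.
(* The largest [N] with [8 * N ^ 7 <= n] also gives [n < 8 * (N + 1) ^ 7 <= 1024 * N ^ 7]. *)
case: (ex_maxnP ex ub) => N Nn Nmax.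
have N128 : (128 <= N)%N by apply: Nmax; rewrite -bE.
have N0 : (0 < N)%N by exact: leq_trans N128.
have nN : (n < 8 * N.+1 ^ 7)%N.
  by rewrite ltnNge; apply/negP => /Nmax; rewrite ltnn.
have [|p [h1 h2 h3]] := @large_config R N n N128; first by rewrite Nn.
exists p; split => //; apply: le_trans h3 _; rewrite -/A.
have n1024 : (n <= 1024 * N ^ 7)%N.
  apply: leq_trans (ltnW nN) _; rewrite -[1024%N]/(8 * 2 ^ 7)%N -mulnA -expnMn.
  by rewrite leq_mul2l leq_exp2r//=; move: N0; clear; lia.
have := powR_scale R N0 n1024 (ltnW n2) => h.
have : A * (N%:R ^+ 6)^-1 <= A * (1024 * n%:R `^ (- (6 / 7)))
  by rewrite ler_wpM2l// ltW.
have : 0 <= b%:R ^+ 3 * n%:R `^ (- (6 / 7)) :> R by exact: mulr_ge0 b0 (ltW P0).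
lra.
Qed.
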